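(* Let $n,r,k,j$ be integers with $n\ge 5r+18$, $r+1\ge k\ge 7$ and $j\ge 6$, and let $U$ be a graph on $k$ vertices with $j$ edges which contains $K_3\cup P_3$ as a subgraph, but contains neither a cycle on $4$ vertices nor $Z_4$ as a subgraph. Then $$\sigma\big(K_{r+1}-U,\,n\big)=\begin{cases}(r-1)(2n-r)-3(n-r)-1, & \text{if } n-r \text{ is odd},\\ (r-1)(2n-r)-3(n-r), & \text{if } n-r \text{ is even}.\end{cases}$$
   Context: A sequence $\pi=(d_1,\dots,d_n)$ of non-increasing nonnegative integers is graphic if it is the degree sequence of a simple graph on $n$ vertices (a realization of $\pi$); write $\sigma(\pi)=d_1+\dots+d_n$. For a graph $H$, $\pi$ is potentially $H$-graphic if some realization of $\pi$ contains $H$ as a (not necessarily induced) subgraph. $\sigma(H,n)$ denotes the smallest even integer $l$ such that every $n$-term graphic sequence $\pi$ with $\sigma(\pi)\ge l$ is potentially $H$-graphic. For a graph $H$ that is a subgraph of $K_m$, $K_m-H$ is the graph obtained from $K_m$ by deleting the edges of $H$. $K_3$ is the triangle, $P_3$ denotes the path with $3$ edges (on $4$ vertices), and $K_3\cup P_3$ is their disjoint union. $Z_4$ denotes $K_4-P_2$, where $P_2$ is the path with $2$ edges, i.e. $Z_4$ is a triangle with one pendant edge attached. *)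

(* Defs.v *)
From mathcomp Require Import all_boot.
Set Implicit Arguments. Unset Strict Implicit. Unset Printing Implicit Defensive.

Definition simple_graph (n : nat) (G : rel 'I_n) : Prop :=
  (forall x y, G x y = G y x) /\ (forall x, ~~ G x x).

Definition deg (n : nat) (G : rel 'I_n) (x : 'I_n) : nat := #|[set y | G x y]|.

Definition num_edges (n : nat) (G : rel 'I_n) : nat :=
  #|[set p : 'I_n * 'I_n | (p.1 < p.2) && G p.1 p.2]|.

Definition subgraph (m n : nat) (H : rel 'I_m) (G : rel 'I_n) : Prop :=
  exists f : 'I_m -> 'I_n, injective f /\ forall x y, H x y -> G (f x) (f y).

Definition graph_of_edges (m : nat) (E : seq (nat * nat)) : rel 'I_m :=
  fun x y => ((val x, val y) \in E) || ((val y, val x) \in E).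

(* K_3 ∪ P_3 : triangle 0,1,2 and path 3-4-5-6 with 3 edges *)
Definition K3_cup_P3 : rel 'I_7 :=
  graph_of_edges [:: (0,1); (1,2); (0,2); (3,4); (4,5); (5,6)].
Definition C4 : rel 'I_4 := graph_of_edges [:: (0,1); (1,2); (2,3); (3,0)].
(* Z_4 = K_4 - P_2 : triangle with a pendant edge *)
Definition Z4 : rel 'I_4 := graph_of_edges [:: (0,1); (1,2); (0,2); (2,3)].

(* K_m - U for U a graph on k <= m vertices, U placed on the first k vertices
   of K_m *)
Definition Km_minus (m k : nat) (U : rel 'I_k) : rel 'I_m :=
  fun x y => (x != y) &&
    ~~ [exists a : 'I_k, exists b : 'I_k,
          [&& val a == val x, val b == val y & U a b]].

Definition realization (n : nat) (pi : seq nat) (G : rel 'I_n) : Prop :=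
  simple_graph G /\ forall x : 'I_n, deg G x = nth 0 pi x.

Definition graphic (n : nat) (pi : seq nat) : Prop :=
  size pi = n /\ sorted geq pi /\ exists G : rel 'I_n, realization pi G.

Definition potentially_graphic (m n : nat) (H : rel 'I_m) (pi : seq nat) : Prop :=
  exists G : rel 'I_n, realization pi G /\ subgraph H G.

Definition sigma_property (m n : nat) (H : rel 'I_m) (l : nat) : Prop :=
  forall pi : seq nat, graphic n pi -> l <= sumn pi ->
    potentially_graphic n H pi.

Definition is_sigma (m n : nat) (H : rel 'I_m) (l : nat) : Prop :=
  ~~ odd l /\ sigma_property n H l /\
  forall l', ~~ odd l' -> sigma_property n H l' -> l <= l'.

(* Main.v *)
Require Import Defs.
From mathcomp Require Import all_boot all_order all_algebra fingroup perm.
From mathcomp Require Import zify.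
Set Implicit Arguments. Unset Strict Implicit. Unset Printing Implicit Defensive.

(* Lower bound: in every realization of ((n-1)^(r-3), [r-1], (r-2)^...) the first
   r - 3 vertices are universal and the others span a matching, or a matching and a
   path with two edges. A copy of K_{r+1} - U has at least four vertices outside the
   universal ones; there U contains the complement of two disjoint edges (C_4) or of
   a path with two edges (Z_4).

   Upper bound: it is enough to find K_{r+1} minus the edges of K_3 u P_3 on the r + 1
   vertices of largest degree. Low-degree ones among the last two of them are laid
   off first, onto vertices of largest remaining degree, so that the non-edges created
   lie in a K_3 u P_3. It remains to realize the residual degrees with the other p
   vertices (p = r - 1, r or r + 1) forming a clique. An Erdos-Gallai type criterion
   decides this; a violated inequality (S, T) with |S| <= r - 3 leaves too few degrees
   above |S| for the given degree sum, and the cases |S| = r - 2, r - 1 are excluded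
   by parity. *)

(** * Cut condition and laying off *)

(** The criterion has an independent part because the edges of the prescribed clique on [A] are
    subtracted from the demands: what is left must be realized with no further edge inside [A]. Such
    a condition also survives the removal of a vertex of [A], which is what a Havel-Hakimi induction
    needs. A full clique on the [r + 1] largest vertices cannot be demanded, as some of them may
    have degree only r - 1 or r - 2. The clique on the first r - 1 vertices needs r - 2 units from
    each of its members, so a member of degree r - 1 can serve only one of the two stars. This and
    the order of the residual demands dictate the neighbours; the missing edges then lie in a
    triangle, in a P_3, or in an edge and a disjoint path with two edges, all inside K_3 u P_3. The
    limit r - 3 on |S| comes from a comparison of slopes: with q = r - |S|, a violated inequality
    needs roughly 2q|B| <= 5|B| plus terms quadratic in q, where 5|B| is the deficit that the degree
    sum allows. For q >= 3 and large |B| this is false; for q <= 2 size decides nothing, and the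
    units have to be counted exactly. *)

Section Criterion.
Variable V : finType.
Implicit Types (A B S T N : {set V}) (d : V -> nat).

(* This is the Erdos-Gallai condition for graphs on [A :|: B] in which [A] is
   independent, one inequality per pair [S], [T]; the summand [#|T|] on the left
   turns the term #|T|(#|T| - 1) on the right into a square. *)
Definition cut_cond A B d := forall S T, S \subset A -> T \subset B ->
  \sum_(x in S) d x + \sum_(x in T) d x + #|T| <=
  2 * #|S| * #|T| + #|T| * #|T| + \sum_(x in A :\: S) minn (d x) #|T|
  + \sum_(x in B :\: T) minn (d x) (#|S| + #|T|).

(** The subtraction truncates at 0; [lay_off_pos] shows that this does not happen on the sets used,
    so that exactly [#|N|] units disappear. *)
Definition lay_off N d : V -> nat := fun x => d x - (x \in N).

Definition top_in B d N :=
  N \subset B /\ forall x y, x \in N -> y \in B :\: N -> d y <= d x.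

Lemma top_exists B d m : m <= #|B| -> exists N, top_in B d N /\ #|N| = m.
Proof.
elim: m => [|m IH] Hm.
  exists set0; split; last by rewrite cards0.
  by split; [exact: sub0set|move=> x y; rewrite inE].
have [N [[NB Ntop] cN]] := IH (ltnW Hm).
have /set0Pn [z0 z0P] : B :\: N != set0.
  rewrite -card_gt0 cardsD (setIidPr NB) cN; lia.
have [z zP zmax] := arg_maxnP (P := fun z => z \in B :\: N) d z0P.
move: (zP); rewrite inE => /andP[zN zB].
exists (z |: N); split; last by rewrite cardsU1 zN cN; lia.
split=> [|x y]; first by rewrite subUset sub1set zB NB.
rewrite !inE negb_or => /orP[/eqP ->|xN] /andP[/andP[yz yN] yB].
  by apply: zmax; rewrite inE yN yB.
by apply: Ntop => //; rewrite inE yN yB.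
Qed.

Lemma lex_max (I : finType) (P : pred I) (f : I -> int) (g h : I -> nat) (i0 : I) :
  P i0 -> exists i, [/\ P i, forall j, P j -> (f j <= f i)%R,
    forall j, P j -> f j = f i -> g j <= g i &
    forall j, P j -> f j = f i -> g j = g i -> h i <= h j].
Proof.
move=> P0.
case: (@Order.TotalTheory.arg_maxP _ _ _ i0 P f P0) => i1 P1 M1.
have P1' : P i1 && (f i1 == f i1) by rewrite P1 eqxx.
have [i2 /andP[P2 /eqP E2] M2] :=
  arg_maxnP (P := fun i => P i && (f i == f i1)) g P1'.
have P2' : [&& P i2, f i2 == f i1 & g i2 == g i2] by rewrite P2 E2 !eqxx.
have [i3 /and3P[P3 /eqP E3 /eqP G3] M3] :=
  arg_minnP (P := fun i => [&& P i, f i == f i1 & g i == g i2]) h P2'.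
exists i3; split=> // [j Pj|j Pj Ej|j Pj Ej Gj].
- by rewrite E3; apply: M1.
- by rewrite G3; apply: M2; rewrite Pj Ej E3 eqxx.
- by apply: M3; rewrite Pj Ej E3 Gj G3 !eqxx.
Qed.

Lemma sum_min_succ (X : {set V}) d k :
  \sum_(x in X) minn (d x) k.+1 =
  \sum_(x in X) minn (d x) k + \sum_(x in X) (k < d x).
Proof. by rewrite -big_split /=; apply: eq_bigr => x _; lia. Qed.

Lemma sum_sub_split (X Y : {set V}) (f : V -> nat) : X \subset Y ->
  \sum_(x in Y) f x = \sum_(x in X) f x + \sum_(x in Y :\: X) f x.
Proof. by move=> XY; rewrite (big_setID X) /= (setIidPr XY). Qed.

Lemma sum_disjU (X Y : {set V}) (f : V -> nat) : [disjoint X & Y] ->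
  \sum_(x in X :|: Y) f x = \sum_(x in X) f x + \sum_(x in Y) f x.
Proof.
move=> dXY; rewrite (sum_sub_split _ (subsetUl X Y)); congr (_ + _).
apply: eq_bigl => x; rewrite !inE.
by case: (boolP (x \in X)) => //= xX; rewrite (disjointFr dXY xX).
Qed.

Definition excess A B d S T : int :=
  (Posz (\sum_(x in S) d x + \sum_(x in T) d x + #|T|) -
   Posz (2 * #|S| * #|T| + #|T| * #|T| + \sum_(x in A :\: S) minn (d x) #|T|
  + \sum_(x in B :\: T) minn (d x) (#|S| + #|T|)))%R.

Lemma cut_condP A B d : cut_cond A B d <->
  (forall S T, S \subset A -> T \subset B -> (excess A B d S T <= 0)%R).
Proof.
split=> H S T SA TB; have := H S T SA TB; rewrite /excess;
  move: (_ + _ + #|T|) (_ + _ + _ + _) => a b; lia.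
Qed.

Lemma excess_add A B d S T x : x \in B -> x \notin T ->
  let k := #|S| + #|T| in
  (excess A B d S (x |: T) = excess A B d S T + Posz (d x + minn (d x) k)
   - Posz (2 * k) - Posz (\sum_(z in A :\: S) (#|T| < d z))
   - Posz (\sum_(z in B :\: T) (k < d z)) + Posz (k < d x))%R.
Proof.
move=> xB xT /=; rewrite /excess.
have -> : B :\: (x |: T) = (B :\: T) :\ x by rewrite setDDl setUC.
rewrite (big_setU1 (A := T) x) //= cardsU1 xT /= add1n [#|S| + _]addnS !sum_min_succ.
rewrite [\sum_(z in B :\: T) minn _ _](big_setD1 x) /=; last by rewrite inE xT.
rewrite [\sum_(z in B :\: T) nat_of_bool _](big_setD1 x) /=; last by rewrite inE xT.
lia.
Qed.



Lemma sum_mem (X N : {set V}) : \sum_(x in X) (x \in N) = #|X :&: N|.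
Proof.
rewrite -sum1_card big_mkcond [RHS]big_mkcond; apply: eq_bigr => x _.
by rewrite inE; case: (x \in X); case: (x \in N).
Qed.

Lemma sum_lay_off (X N : {set V}) d : (forall x, x \in N -> 0 < d x) ->
  \sum_(x in X) d x = \sum_(x in X) lay_off N d x + #|X :&: N|.
Proof.
move=> Npos; rewrite -sum_mem -big_split /=; apply: eq_bigr => x _.
by rewrite /lay_off; case: (boolP (x \in N)) => /= [/Npos|_]; lia.
Qed.

Lemma even_lay_off A B d i N : [disjoint A & B] -> i \in A -> N \subset B ->
  #|N| = d i -> (forall x, x \in N -> 0 < d x) ->
  ~~ odd (\sum_(x in A) d x + \sum_(x in B) d x) ->
  ~~ odd (\sum_(x in A :\ i) lay_off N d x + \sum_(x in B) lay_off N d x).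
Proof.
move=> dAB iA NB cN Npos.
have := sum_lay_off A Npos; have := sum_lay_off B Npos.
have -> : A :&: N = set0.
  by apply/eqP; rewrite setI_eq0; apply: disjointWr NB dAB.
rewrite cards0 (setIidPr NB) cN => -> ->.
rewrite (big_setD1 i) //=.
have -> : lay_off N d i = d i.
  rewrite /lay_off; case: (boolP (i \in N)) => [iN|_]; last by rewrite subn0.
  by have := disjointFr dAB iA; rewrite (subsetP NB _ iN).
by rewrite !oddD /=; case: (odd (d i)); case: (odd (\sum_(x in A :\ i) _)); case: (odd (\sum_(x in B) _)).
Qed.

(** * Laying off an independent vertex onto the largest demands keeps the cut condition *)

Section LayOff.
Variables (A B N : {set V}) (d : V -> nat) (i : V).
Hypothesis disjAB : [disjoint A & B].
Hypothesis cut_condd : cut_cond A B d.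
Hypothesis iA : i \in A.
Hypothesis topN : top_in B d N.
Hypothesis cardN : #|N| = d i.
Hypothesis evend : ~~ odd (\sum_(x in A) d x + \sum_(x in B) d x).

Let d' := lay_off N d.
Let A' := A :\ i.

Let NB : N \subset B. Proof. by case: topN. Qed.

Let AN x : x \in A -> x \notin N.
Proof. by move=> xA; apply/negP => /(subsetP NB); rewrite (disjointFr disjAB xA). Qed.

(** The inequality of [([set i], set0)] says that at least [d i] vertices of [B] have positive
    demand; a zero inside the top set [N] of size [d i] would leave fewer. *)
Lemma lay_off_pos x : x \in N -> 0 < d x.
Proof.
move=> xN; rewrite lt0n; apply/negP => /eqP dx0.
have := cut_condd (S := [set i]) (T := set0); rewrite sub1set iA sub0set.
move=> /(_ isT isT); rewrite big_set1 big_set0 cards0 cards1 !muln0 setD0.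
rewrite [X in _ <= _ + X + _]big1 ?addn0 /=; last by move=> z _; rewrite minn0.
have -> : \sum_(z in B) minn (d z) 1 = \sum_(z in N) minn (d z) 1.
  rewrite (sum_sub_split _ NB) [X in _ + X]big1 ?addn0 // => z zP.
  by have [_ /(_ x z xN zP)] := topN; move: dx0; clear; lia.
rewrite (big_setD1 x) //= dx0 -cardN (cardsD1 x) xN.
suff : \sum_(z in N :\ x) minn (d z) 1 <= #|N :\ x| by clear; lia.
by rewrite -sum1_card; apply: leq_sum => z _; clear; lia.
Qed.

Let Npos := lay_off_pos.

Let d'A x : x \in A -> d' x = d x.
Proof. by move=> /AN xN; rewrite /d' /lay_off (negPf xN) subn0. Qed.

Let d'N x : x \in N -> d x = (d' x).+1.
Proof. by move=> xN; rewrite /d' /lay_off xN; have := Npos xN; clear; lia. Qed.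

Let d'out x : x \notin N -> d' x = d x.
Proof. by move=> xN; rewrite /d' /lay_off (negPf xN) subn0. Qed.

Let even' : ~~ odd (\sum_(x in A') d' x + \sum_(x in B) d' x).
Proof. exact: even_lay_off. Qed.

Section FixS.
Variable S : {set V}.
Hypothesis SA : S \subset A'.

Let sumS : \sum_(x in S) d' x = \sum_(x in S) d x.
Proof.
by apply: eq_bigr => x /(subsetP SA); rewrite inE => /andP[_ xA]; rewrite d'A.
Qed.

Let sumA t : \sum_(x in A' :\: S) minn (d' x) t = \sum_(x in A' :\: S) minn (d x) t.
Proof.
by apply: eq_bigr => x; rewrite !inE => /and3P[_ _ xA]; rewrite d'A.
Qed.

Let iS : i \notin S.
Proof. by apply/negP => /(subsetP SA); rewrite !inE eqxx. Qed.

Let AS : A :\: S = i |: (A' :\: S).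
Proof.
by apply/setP=> x; rewrite !inE; case: eqP => [->|_] //=; rewrite iA iS.
Qed.

Let cut_cond_without T : T \subset B ->
  \sum_(x in S) d x + \sum_(x in T) d x + #|T| <=
  2 * #|S| * #|T| + #|T| * #|T| + \sum_(x in A' :\: S) minn (d x) #|T|
  + \sum_(x in B :\: T) minn (d x) (#|S| + #|T|) + minn (d i) #|T|.
Proof.
move=> TB; have := cut_condd (S := S) (T := T) _ TB.
rewrite AS big_setU1 /=; last by rewrite !inE eqxx andbF.
move=> /(_ (subset_trans SA (subD1set _ _))); clear; lia.
Qed.

Let cut_cond_with T : T \subset B ->
  d i + \sum_(x in S) d x + \sum_(x in T) d x + #|T| <=
  2 * #|S| * #|T| + 2 * #|T| + #|T| * #|T| + \sum_(x in A' :\: S) minn (d x) #|T|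
  + \sum_(x in B :\: T) minn (d x) (#|S| + #|T|).+1.
Proof.
move=> TB; have := cut_condd (S := i |: S) (T := T) _ TB.
rewrite big_setU1 //= -setDDl cardsU1 iS /= add1n [_.+1 + #|T|]addSn.
rewrite subUset sub1set iA (subset_trans SA (subD1set _ _)) => /(_ isT).
rewrite -/A'; clear; lia.
Qed.

(** The old inequality with [i] outside [S] suffices: the sum over [T] drops by [#|N| = d i], at
    least as much as the lost summand [minn (d i) #|T|]. *)
Let nested_super T : T \subset B -> N \subset T -> (excess A' B d' S T <= 0)%R.
Proof.
move=> TB NT; have := cut_cond_without TB; rewrite /excess sumS sumA.
rewrite (sum_lay_off T Npos) (setIidPr NT) cardN.
have -> : \sum_(x in B :\: T) minn (d' x) (#|S| + #|T|) =
          \sum_(x in B :\: T) minn (d x) (#|S| + #|T|).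
  apply: eq_bigr => x; rewrite inE => /andP[xT _]; rewrite d'out //.
  by apply: contra xT; apply: (subsetP NT).
rewrite -/d'; clear; lia.
Qed.

(** If some demand in [N :\: T] is at most |S| + |T|, so are all demands outside [N]; then the old
    inequality with [i] added to [S] works, its higher cap being paid for by the units laid off on
    [N :\: T]. Otherwise the cap |S| + |T| is reached on [N :\: T] both before and after laying off,
    and the inequality with [i] outside [S] works. *)
Let nested_sub T : T \subset B -> T \subset N -> (excess A' B d' S T <= 0)%R.
Proof.
move=> TB TN; rewrite /excess sumS sumA.
have eT : \sum_(x in T) d x = \sum_(x in T) d' x + #|T|.
  by rewrite (sum_lay_off T Npos) (setIidPl TN).
have tdi : #|T| <= d i by rewrite -cardN subset_leq_card.
have [/existsP[x /andP[xNT dx]]|/existsPn big] :=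
    boolP [exists x, (x \in N :\: T) && (d x <= #|S| + #|T|)].
  have := cut_cond_with TB.
  have -> : \sum_(z in B :\: T) minn (d z) (#|S| + #|T|).+1 =
      \sum_(z in B :\: T) minn (d' z) (#|S| + #|T|) + #|N :\: T|.
    have -> : #|N :\: T| = #|(B :\: T) :&: N|.
      congr #|pred_of_set _|; apply/setP=> z; rewrite !inE.
      by case: (boolP (z \in N)) => [/(subsetP NB) ->|]; rewrite ?andbT ?andbF.
    rewrite -sum_mem -big_split /=; apply: eq_bigr => z; rewrite inE => /andP[zT zB].
    have [zN|zN] := boolP (z \in N); first by rewrite (d'N zN); clear; lia.
    rewrite d'out //; move: xNT; rewrite inE => /andP[_ xN].
    have [_ /(_ x z xN)] := topN; rewrite inE zN zB => /(_ isT).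
    by move: dx; clear; lia.
  have : #|N :\: T| = d i - #|T| by rewrite cardsD (setIidPr TN) cardN.
  move: eT tdi; clear; lia.
have := cut_cond_without TB.
have -> : \sum_(z in B :\: T) minn (d' z) (#|S| + #|T|) =
          \sum_(z in B :\: T) minn (d z) (#|S| + #|T|).
  apply: eq_bigr => z; rewrite inE => /andP[zT zB].
  have [zN|zN] := boolP (z \in N); last by rewrite d'out.
  by have := big z; rewrite inE zT zN /= (d'N zN); clear; lia.
move: eT tdi; clear; lia.
Qed.

(* Take [U] of maximal excess, then with [U :&: N] maximal, then with [U] minimal.
   If [U] and [N] are not nested, all demands in [U :\: N] and [N :\: U] agree;
   the effect of removing one vertex or adding one forces this common value to be
   [#|S| + #|U|], and then parity makes the excess at least 2, whereas passing to
   [U :&: N] lowers it by at most 1. *)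
Lemma lay_off_excess T : T \subset B -> (excess A' B d' S T <= 0)%R.
Proof.
move=> TB0.
pose P T := T \subset B.
have [U [/= UB Fmax Gmax Hmin]] := lex_max (P := P) (fun U => excess A' B d' S U)
   (fun U => #|U :&: N|) (fun U => #|U|) TB0.
apply: Order.POrderTheory.le_trans (Fmax _ TB0) _.
rewrite Order.TotalTheory.leNgt; apply/negP => Upos.
have [/set0Pn[y yU]|] := boolP (U :\: N != set0); last first.
  rewrite negbK setD_eq0 => UN.
  by have := nested_sub UB UN; move: Upos; clear; lia.
have [/set0Pn[x xN]|] := boolP (N :\: U != set0); last first.
  rewrite negbK setD_eq0 => NU.
  by have := nested_super UB NU; move: Upos; clear; lia.
set s := #|S|; set t := #|U|; set k := s + t.
(* Otherwise exchanging [y'] for [x'] would increase the excess, or keep it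
   while enlarging [U :&: N]. *)
have plateau x' y' : x' \in N :\: U -> y' \in U :\: N -> d x' = d y'.
  rewrite !inE => /andP[x'U x'N] /andP[y'N y'U].
  have y'B := subsetP UB _ y'U; have x'B := subsetP NB _ x'N.
  have [_ /(_ x' y' x'N)] := topN; rewrite inE y'N y'B => /(_ isT) dle.
  have xy : x' != y' by apply: contraNneq x'U => ->.
  apply/eqP; rewrite eqn_leq dle andbT leqNgt; apply/negP => dlt.
  have y'D : y' \notin U :\ y' by rewrite !inE eqxx.
  have x'D : x' \notin U :\ y' by rewrite !inE negb_and x'U orbT.
  have DB : U :\ y' \subset B by apply: subset_trans UB; apply: subD1set.
  have E1 := excess_add A' d' S y'B y'D; have E2 := excess_add A' d' S x'B x'D.
  rewrite setD1K // in E1.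
  have XB : P (x' |: (U :\ y')) by rewrite /P subUset sub1set x'B DB.
  have : (excess A' B d' S (x' |: (U :\ y')) < excess A' B d' S U)%R.
    rewrite Order.POrderTheory.lt_neqAle Fmax // andbT; apply/eqP => FE.
    have := Gmax _ XB FE; apply/negP; rewrite -ltnNge.
    have -> : (x' |: U :\ y') :&: N = x' |: (U :\ y') :&: N.
      by rewrite setIUl (setIidPl (_ : [set x'] \subset N)) ?sub1set.
    rewrite cardsU1 !inE (negPf x'U) andbF /=.
    rewrite add1n ltnS; apply: subset_leq_card; apply/subsetP => z.
    by rewrite !inE; case: eqP => [->|]; rewrite ?(negPf y'N) ?andbF.
  have d'y : d' y' = d y' by rewrite d'out.
  have d'x := d'N x'N.
  move: E1 E2 d'y d'x dlt dle; cbv zeta; rewrite -/d'.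
  move: (excess _ _ _ _ _) (excess _ _ _ _ _) (excess _ _ _ _ _) => F1 F2 F3.
  move: (\sum_(z in _) _) (\sum_(z in _) _) => c1 c2; clear; lia.
move: (yU) (xN); rewrite !inE => /andP[yN yU'] /andP[xU xN'].
have yB := subsetP UB _ yU'; have xB := subsetP NB _ xN'.
have d'y : d' y = d y by rewrite d'out.
have d'x : d y = (d' x).+1 by rewrite -(plateau x y xN yU) d'N.
pose U0 := U :\ y.
have yU0 : y \notin U0 by rewrite !inE eqxx.
have U0B : P U0 by apply: subset_trans UB; apply: subD1set.
have tE : t = #|U0|.+1 by rewrite /t (cardsD1 y) yU'.
have remove_lt : (excess A' B d' S U0 < excess A' B d' S U)%R.
  rewrite Order.POrderTheory.lt_neqAle Fmax // andbT; apply/eqP => FE.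
  have : #|U| <= #|U0|; last by rewrite -/t tE ltnn.
  apply: Hmin => //; congr #|pred_of_set _|; apply/setP => z; rewrite !inE.
  by case: eqP => [->|]; rewrite ?(negPf yN) ?andbF.
have add_lt : (excess A' B d' S (x |: U) < excess A' B d' S U)%R.
  have XB : P (x |: U) by rewrite /P subUset sub1set xB.
  rewrite Order.POrderTheory.lt_neqAle Fmax // andbT; apply/eqP => FE.
  have := Gmax _ XB FE.
  have -> : (x |: U) :&: N = x |: U :&: N.
    by rewrite setIUl (setIidPl (_ : [set x] \subset N)) ?sub1set.
  by rewrite cardsU1 !inE (negPf xU) ltnn.
have Erem := excess_add A' d' S yB yU0; rewrite setD1K // in Erem.
have Eadd := excess_add A' d' S xB xU.
cbv zeta in Erem, Eadd; rewrite -/s -/t -/k d'y in Erem Eadd.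
set k0 := s + #|U0| in Erem; have kE : k = k0.+1 by rewrite /k tE /k0; clear; lia.
pose cA j := \sum_(z in A' :\: S) (j < d' z).
pose cB j := \sum_(z in (B :\: U) :\ x) (j < d' z).
have cA_mono : cA t <= cA #|U0|.
  by apply: leq_sum => z _; rewrite tE; clear; lia.
have cB_mono : cB k <= cB k0 by apply: leq_sum => z _; rewrite kE; clear; lia.
have cBk j : \sum_(z in B :\: U) (j < d' z) = (j < d' x) + cB j.
  by rewrite (big_setD1 x) //= inE xU xB.
have cBk0 : \sum_(z in B :\: U0) (k0 < d' z) = (k0 < d y) + ((k0 < d' x) + cB k0).
  rewrite -cBk -d'y (big_setD1 y) /=; last by rewrite inE yU0 yB.
  congr (_ + _); apply: eq_bigl => z; rewrite !inE.
  by case: eqP => [->|] //=; rewrite yU'.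
rewrite cBk -/(cA t) in Eadd; rewrite cBk0 -/(cA _) in Erem.
(* Removing [y] and adding [x] both strictly lower the excess. As [d' x] is one less than [d y], the
   two increments are compatible only if [d y = k] and no other demand exceeds the caps. *)
have [bk cA0 cB0] : [/\ d y = k, cA #|U0| = 0 & cB k0 = 0].
  move: Erem Eadd remove_lt add_lt d'x kE cA_mono cB_mono.
  move: (excess _ _ _ _ _) (excess _ _ _ _ _) (excess _ _ _ _ _) => F1 F2 F3.
  by move: (cA _) (cA _) (cB _) (cB _) => c1 c2 c3 c4; clear => *; split; lia.
have A'le z : z \in A' :\: S -> d' z <= #|U0|.
  move=> zP; move/eqP: cA0; rewrite sum_nat_eq0 => /forallP/(_ z).
  by rewrite zP; clear; lia.
have Ble z : z \in B :\: U -> d' z <= k0.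
  have [-> _|zx zP] := eqVneq z x; first by move: d'x bk kE; clear; lia.
  move/eqP: cB0; rewrite sum_nat_eq0 => /forallP/(_ z).
  by rewrite in_setD1 zx zP; clear; lia.
have evenF : (2 <= excess A' B d' S U)%R.
  have sumA'm : \sum_(z in A' :\: S) minn (d' z) t = \sum_(z in A' :\: S) d' z.
    by apply: eq_bigr => z /A'le; rewrite tE; clear; lia.
  have sumBm : \sum_(z in B :\: U) minn (d' z) k = \sum_(z in B :\: U) d' z.
    by apply: eq_bigr => z /Ble; rewrite kE; clear; lia.
  move: Upos even'; rewrite /excess -/s -/t -/k sumA'm sumBm.
  rewrite (sum_sub_split d' SA) (sum_sub_split d' UB).
  have : ~~ odd (t * t + t) by rewrite oddD oddM; case: (odd t).
  move: (t * t) (\sum_(z in S) _) (\sum_(z in U) _) (\sum_(z in _ :\: _) _) (\sum_(z in _ :\: _) _).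
  clear; lia.
pose U1 := U :&: N.
have U1B : U1 \subset B by apply: subset_trans NB; apply: subsetIr.
have := nested_sub U1B (subsetIr _ _).
set e := #|U :\: N|; have e1 : 0 < e by rewrite card_gt0; apply/set0Pn; exists y.
have tE1 : t = #|U1| + e by rewrite /t -(cardsID N).
have sumU : \sum_(z in U) d' z = \sum_(z in U1) d' z + e * k.
  rewrite (big_setID N) /=; congr (_ + _); rewrite -sum_nat_const.
  apply: eq_bigr => z zP; rewrite -bk d'out; last by move: zP; rewrite inE => /andP[].
  by rewrite -(plateau x z xN zP) (plateau x y xN yU).
have sumB1 : \sum_(z in B :\: U1) minn (d' z) (s + #|U1|) =
    \sum_(z in B :\: U) minn (d' z) (s + #|U1|) + e * (s + #|U1|).
  rewrite (big_setID U) /= addnC; congr (_ + _).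
    apply: eq_bigl => z; rewrite !inE.
    by case: (z \in U); case: (z \in N).
  rewrite -sum_nat_const; apply: eq_big => z.
    rewrite !inE; case: (boolP (z \in U)) => [/(subsetP UB) ->|]; rewrite ?andbF //=.
    by rewrite andbT.
  rewrite !inE => /andP[/andP[zN zB] zU].
  have zP : z \in U :\: N by rewrite inE zU andbT; move: zN; rewrite zU.
  have zN' : z \notin N by move: zP; rewrite inE => /andP[].
  rewrite d'out // -(plateau x z xN zP) (plateau x y xN yU) bk /k tE1.
  by clear; lia.
(* Here [d' x = k - 1], so lowering the cap from [k] to [k - e] costs [e - 1] at [x] alone. This is
   what keeps the drop of the excess from [U] to [U1] at 1 or less. *)
have sumBx : \sum_(z in B :\: U) minn (d' z) (s + #|U1|) + e.-1 <=
             \sum_(z in B :\: U) minn (d' z) k.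
  have xBU : x \in B :\: U by rewrite inE xU xB.
  rewrite !(big_setD1 x xBU) /= addnAC; apply: leq_add.
    by move: d'x bk e1; rewrite /k tE1; clear; lia.
  by apply: leq_sum => z _; rewrite /k tE1; clear; lia.
have sumAx : \sum_(z in A' :\: S) minn (d' z) #|U1| <=
             \sum_(z in A' :\: S) minn (d' z) t.
  by apply: leq_sum => z _; rewrite tE1; clear; lia.
move: evenF sumB1 sumBx sumAx sumU e1; rewrite /excess -/s -/t -/k => + ->.
move: (\sum_(z in A' :\: S) _) (\sum_(z in A' :\: S) _) => a1 a2.
move: (\sum_(z in B :\: U) _) (\sum_(z in B :\: U) _) => b1 b2.
move: (\sum_(z in S) _) (\sum_(z in U) _) (\sum_(z in U1) _) => c1 c2 c3.
rewrite /k tE1; generalize e s #|U1|; clear; nia.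
Qed.

End FixS.

Lemma cut_cond_lay_off : cut_cond A' B d'.
Proof. by apply/cut_condP => S T SA TB; apply: lay_off_excess. Qed.

End LayOff.

(** A single vertex is always independent. The inequality with [i] in [S] is the old one for
    [i |: T], the one with [S] empty is the old one for [T]. *)
Lemma cut_cond_move B d i : i \in B -> cut_cond set0 B d -> cut_cond [set i] (B :\ i) d.
Proof.
move=> iB H S T; rewrite subset1 => /orP[]/eqP-> TB.
  have := H _ (i |: T) (sub0set _).
  rewrite subUset sub1set iB (subset_trans TB (subD1set _ _)) => /(_ isT).
  have iT : i \notin T by apply/negP => /(subsetP TB); rewrite !inE eqxx.
  rewrite !big_set0 !cards0 set0D big_setU1 //= cardsU1 iT /= big_set0 -setDDl.
  rewrite setDv big_set0 big_set1 cards1.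
  by move: (\sum_(x in _) minn _ _) => b; clear; nia.
have := H _ T (sub0set _) (subset_trans TB (subD1set _ _)).
rewrite !big_set0 !cards0 set0D setD0 big_set0 big_set1.
have iT : i \notin T by apply/negP => /(subsetP TB); rewrite !inE eqxx.
rewrite [\sum_(x in B :\: T) _](big_setD1 i) /=; last by rewrite inE iB iT.
have -> : B :\: T :\ i = B :\ i :\: T by rewrite !setDDl setUC.
by clear; lia.
Qed.

End Criterion.

(** * Realizations *)

Section Realization.
Variable V : finType.
Implicit Types (A B S T N : {set V}) (d : V -> nat) (G : rel V).

Definition sgraph G := (forall x y, G x y = G y x) /\ (forall x, ~~ G x x).

Definition valency G x := #|[set y | G x y]|.

Lemma valencyE G x : valency G x = \sum_y G x y.
Proof. by rewrite /valency cardsE -sum1_card big_mkcond. Qed.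

Definition add_star G v N : rel V := fun x y =>
  [|| G x y, (x == v) && (y \in N) | (y == v) && (x \in N)].

Section AddStar.
Variables (G : rel V) (v : V) (N : {set V}).
Hypotheses (sG : sgraph G) (Gv : forall y, ~~ G v y) (vN : v \notin N).

Lemma sgraph_add_star : sgraph (add_star G v N).
Proof.
have [Gs Gi] := sG; split=> [x y|x].
  by rewrite /add_star Gs; case: (G y x) => //=; rewrite orbC.
by rewrite /add_star (negPf (Gi x)) /=; case: eqP => //= ->; rewrite (negPf vN).
Qed.

Lemma valency_add_star_center : valency (add_star G v N) v = #|N|.
Proof.
congr #|pred_of_set _|; apply/setP => y.
by rewrite inE /add_star (negPf (Gv y)) eqxx (negPf vN) andbF orbF.
Qed.

Lemma valency_add_star x :
  x != v -> valency (add_star G v N) x = valency G x + (x \in N).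
Proof.
move=> xv; have [Gs Gi] := sG; rewrite /valency.
have -> : [set y | add_star G v N x y] = [set y | G x y] :|: [set y | (y == v) && (x \in N)].
  by apply/setP => y; rewrite !inE /add_star (negPf xv).
case: (x \in N) => /=.
  have -> : [set y | (y == v) && true] = [set v] by apply/setP => y; rewrite !inE andbT.
  by rewrite setUC cardsU1 inE Gs (negPf (Gv x)) addnC.
have -> : [set y | (y == v) && false] = set0 by apply/setP => y; rewrite !inE andbF.
by rewrite setU0 addn0.
Qed.
End AddStar.

Lemma cut_cond_le_card A B d i : cut_cond A B d -> i \in A -> d i <= #|B|.
Proof.
move=> H iA; have := H [set i] set0; rewrite sub1set iA sub0set => /(_ isT isT).
rewrite big_set1 big_set0 cards0 cards1 !muln0 setD0.
rewrite [X in _ <= _ + X + _]big1 ?addn0 /=; last by move=> z _; rewrite minn0.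
by move/leq_trans; apply; rewrite -sum1_card; apply: leq_sum => z _; clear; lia.
Qed.

(** Havel-Hakimi induction on the number of vertices: a vertex of [A] is laid off onto the top of
    [B] and restored as a star. If [A] is empty, some vertex of [B] is first declared
    independent. *)
Theorem cut_cond_realizable A B d : [disjoint A & B] -> cut_cond A B d ->
  ~~ odd (\sum_(x in A) d x + \sum_(x in B) d x) ->
  exists G, [/\ sgraph G, forall x y, G x y -> x \in A :|: B,
    forall x y, G x y -> ~~ ((x \in A) && (y \in A)) &
    forall x, x \in A :|: B -> valency G x = d x].
Proof.
elim: {A B}_.+1 {-2}A {-2}B (ltnSn #|A :|: B|) d => // m IH A B.
have step A' B' d i : #|A' :|: B'| <= m -> i \in A' ->
    [disjoint A' & B'] -> cut_cond A' B' d ->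
  ~~ odd (\sum_(x in A') d x + \sum_(x in B') d x) ->
  exists G, [/\ sgraph G, forall x y, G x y -> x \in A' :|: B',
    forall x y, G x y -> ~~ ((x \in A') && (y \in A')) &
    forall x, x \in A' :|: B' -> valency G x = d x].
  move=> lem iA dAB cr ev.
  have [N [topN cN]] := top_exists d (cut_cond_le_card cr iA).
  have cr' := cut_cond_lay_off dAB cr iA topN cN ev.
  have [NB _] := topN.
  have Npos := lay_off_pos cr iA topN cN.
  have iB : i \notin B' by rewrite (disjointFr dAB iA).
  have iN : i \notin N by apply: contra iB; apply: (subsetP NB).
  have dAB' : [disjoint A' :\ i & B'] by apply: disjointWl dAB; apply: subD1set.
  have [||G [sG Gs Gi Gd]] := IH _ _ _ _ dAB' cr'.
  - apply: leq_trans lem; apply: proper_card; apply/properP; split.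
      by apply: setSU; apply: subD1set.
    by exists i; rewrite !inE ?iA // eqxx (negPf iB).
  - exact: even_lay_off.
  have Gv y : ~~ G i y.
    by apply/negP => /Gs; rewrite !inE eqxx (negPf iB).
  exists (add_star G i N); split.
  - exact: sgraph_add_star.
  - move=> x y; case/or3P => [/Gs|/andP[/eqP-> _]|/andP[_ /(subsetP NB)]].
    + by rewrite !inE => /orP[/andP[_ ->]|->] //; rewrite orbT.
    + by rewrite inE iA.
    + by rewrite inE orbC => ->.
  - have AB z : z \in N -> z \notin A'.
      by move=> /(subsetP NB) zB; rewrite (disjointFl dAB zB).
    move=> x y; case/or3P => [H|/andP[/eqP-> /AB]|/andP[/eqP-> /AB]];
      try by move=> /negPf->; rewrite ?andbF.
    have := Gi _ _ H; rewrite !inE.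
    have -> : x != i by apply: contraTneq H => ->.
    by have -> : y != i by apply: contraTneq H => ->; case: sG => -> _.
  - move=> x xAB; have [->|xi] := eqVneq x i.
      by rewrite valency_add_star_center.
    rewrite valency_add_star // Gd; last by move: xAB; rewrite !inE xi.
    by rewrite /lay_off; case: (boolP (x \in N)) => [/Npos|_]; clear; lia.
move=> lem d dAB cr ev.
have [/existsP[i iA]|/existsPn noA] := boolP [exists i, i \in A].
  exact: step i _ iA dAB cr ev.
have A0 : A = set0 by apply/setP => x; rewrite inE; exact/negbTE/(noA x).
subst A; have [/existsP[i iB]|/existsPn noB] := boolP [exists i, i \in B].
  have iU : [set i] :|: B :\ i = B by rewrite setD1K.
  have [|||G [sG Gs Gi Gd]] := step [set i] (B :\ i) d i _ (set11 i) _ (cut_cond_move iB cr).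
  - by rewrite iU; rewrite set0U in lem.
  - by rewrite disjoints1 !inE eqxx.
  - by move: ev; rewrite big_set0 big_set1 (big_setD1 i).
  rewrite iU in Gs Gd; exists G; split; rewrite ?set0U //.
  by move=> x y _; rewrite inE.
have B0 : B = set0 by apply/setP => x; rewrite inE; exact/negbTE/(noB x).
exists (fun _ _ => false); split=> //.
by move=> x; rewrite B0 !inE.
Qed.

Lemma erdos_gallai_necessary G : sgraph G -> cut_cond set0 setT (valency G).
Proof.
move=> [Gs Gi] S T; rewrite subset0 => /eqP-> _.
rewrite big_set0 cards0 set0D big_set0 !add0n addn0 setTD.
have -> : \sum_(x in T) valency G x = \sum_y #|[set x in T | G y x]|.
  under eq_bigr do rewrite valencyE.
  rewrite exchange_big /=; apply: eq_bigr => y _.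
  rewrite -sum1_card big_mkcond [RHS]big_mkcond /=; apply: eq_bigr => x _.
  by rewrite inE Gs; case: (x \in T); case: (G y x).
rewrite (bigID (mem T)) /= addnAC; apply: leq_add; last first.
  rewrite (eq_bigl (fun y => y \in ~: T)); last by move=> y; rewrite in_setC.
  apply: leq_sum => y _; rewrite leq_min; apply/andP; split.
    by apply: subset_leq_card; apply/subsetP => x; rewrite !inE => /andP[].
  by apply: subset_leq_card; apply/subsetP => x; rewrite !inE => /andP[].
rewrite -sum_nat_const -{1}sum1_card addnC -big_split /=; apply: leq_sum => y yT.
rewrite (cardsD1 y T) yT !add1n ltnS; apply: subset_leq_card; apply/subsetP => x.
by rewrite !inE => /andP[-> Gyx]; rewrite andbT; apply: contraTneq Gyx => ->.
Qed.

Lemma handshake G : sgraph G -> ~~ odd (\sum_x valency G x).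
Proof.
move=> [Gs Gi].
have -> : \sum_x valency G x =
   \sum_x \sum_(y | enum_rank x < enum_rank y) G x y +
   \sum_x \sum_(y | enum_rank y < enum_rank x) G x y.
  rewrite -big_split /=; apply: eq_bigr => x _; rewrite valencyE.
  rewrite (bigID (fun y => enum_rank x < enum_rank y)) /=; congr (_ + _).
  rewrite [RHS]big_mkcond [LHS]big_mkcond /=; apply: eq_bigr => y _.
  rewrite -leqNgt leq_eqVlt; case: eqP => //= /ord_inj/enum_rank_inj ->.
  by rewrite ltnn (negPf (Gi x)).
rewrite [X in _ + X](exchange_big_dep xpredT) //=.
rewrite [X in _ + X](eq_bigr (fun x => \sum_(y | enum_rank x < enum_rank y) G x y)).
  by rewrite addnn odd_double.
by move=> x _; apply: eq_bigr => y _; rewrite Gs.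
Qed.

Definition add_clique G A : rel V := fun x y =>
  G x y || [&& x \in A, y \in A & x != y].

Lemma sgraph_add_clique G A : sgraph G -> sgraph (add_clique G A).
Proof.
move=> [Gs Gi]; split=> [x y|x]; rewrite /add_clique.
  by rewrite Gs eq_sym; case: (x \in A); case: (y \in A).
by rewrite (negPf (Gi x)) eqxx !andbF.
Qed.

Lemma valency_add_clique G A x :
  (forall x y, G x y -> ~~ ((x \in A) && (y \in A))) ->
  valency (add_clique G A) x = valency G x + (x \in A) * #|A|.-1.
Proof.
move=> Gi; rewrite /valency; case: (boolP (x \in A)) => xA; last first.
  rewrite mul0n addn0; congr #|pred_of_set _|; apply/setP => y.
  by rewrite !inE /add_clique (negPf xA) orbF.
have -> : [set y | add_clique G A x y] = [set y | G x y] :|: A :\ x.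
  by apply/setP => y; rewrite !inE /add_clique xA (eq_sym x y) [_ && (y \in A)]andbC.
rewrite cardsU (_ : _ :&: _ = set0) ?cards0 ?subn0.
  by rewrite mul1n (cardsD1 x A) xA.
by apply/setP => y; rewrite !inE; apply/and3P => -[/Gi]; rewrite xA /= => /negPf->.
Qed.

End Realization.

(** * Cliques in realizations *)

Section Clique.
Variable V : finType.
Implicit Types (A B S T N : {set V}) (d : V -> nat) (G : rel V).

Lemma excess_add_left A B d S T i : i \in A -> i \notin S ->
  (excess A B d (i |: S) T = excess A B d S T + Posz (d i + minn (d i) #|T|)
   - Posz (2 * #|T|) - Posz (\sum_(z in B :\: T) (#|S| + #|T| < d z)%N))%R.
Proof.
move=> iA iS; rewrite /excess.
have -> : A :\: (i |: S) = (A :\: S) :\ i by rewrite setDDl setUC.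
rewrite (big_setU1 (A := S) i) //= cardsU1 iS /= add1n [_.+1 + #|T|]addSn sum_min_succ.
rewrite [\sum_(z in A :\: S) minn _ _](big_setD1 i) /=; last by rewrite inE iS.
by move: (\sum_(x in _) _) => c; clear; lia.
Qed.

(** In a violated pair with |S| + |T| minimal, deleting any one vertex must lower the excess; the
    increment formulas permit this only if the vertex has the stated large demand. *)
Lemma cut_cond_by_minimal A B d :
  (forall S T, S \subset A -> T \subset B -> (0 < excess A B d S T)%R ->
    (forall y, y \in T -> #|S| + #|T| <= d y) ->
    (forall i, i \in S -> #|T| < d i) -> False) -> cut_cond A B d.
Proof.
move=> H; apply/cut_condP => S0 T0 SA0 TB0.
rewrite Order.TotalTheory.leNgt; apply/negP => ex0.
pose P (X : {set V} * {set V}) :=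
  [&& X.1 \subset A, X.2 \subset B & (0 < excess A B d X.1 X.2)%R].
have P0 : P (S0, T0) by rewrite /P /= SA0 TB0 ex0.
have [[S T] /and3P[/= SA TB ex] Hmin] := arg_minnP (fun X : {set V} * {set V} => #|X.1| + #|X.2|) P0.
apply: (H S T) => // [y yT|i iS].
  have yT0 : y \notin T :\ y by rewrite !inE eqxx.
  have yB := subsetP TB _ yT.
  have /= := excess_add A d S yB yT0; rewrite setD1K //.
  have : (excess A B d S (T :\ y) <= 0)%R.
    rewrite Order.TotalTheory.leNgt; apply/negP => ex1.
    have /Hmin /= : P (S, T :\ y).
      by rewrite /P /= SA (subset_trans (subD1set _ _) TB).
    by rewrite (cardsD1 y T) yT; clear; lia.
  have -> : #|T| = #|T :\ y|.+1 by rewrite (cardsD1 y T) yT.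
  have : (#|S| + #|T :\ y| < d y) <= \sum_(z in B :\: (T :\ y)) (#|S| + #|T :\ y| < d z).
    by rewrite (big_setD1 y) /= ?leq_addr // !inE eqxx yB.
  move: ex; move: (\sum_(z in B :\: (T :\ y)) _) (\sum_(z in A :\: S) _).
  move: (excess A B d S T) (excess A B d S _) #|S| #|T :\ y| (d y); clear; lia.
have iS0 : i \notin S :\ i by rewrite !inE eqxx.
have iA := subsetP SA _ iS.
have := excess_add_left B d T iA iS0; rewrite setD1K //.
have : (excess A B d (S :\ i) T <= 0)%R.
  rewrite Order.TotalTheory.leNgt; apply/negP => ex1.
  have /Hmin /= : P (S :\ i, T).
    by rewrite /P /= (subset_trans (subD1set _ _) SA) TB.
  by rewrite (cardsD1 i S) iS; clear; lia.
move: ex; clear.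
by move: (excess _ _ _ _ _) (excess _ _ _ _ _) => e1 e2; lia.
Qed.

(** * Reduction of a clique on [A] to the demands between [A] and [B] *)

Section Reduction.
Variables (A B : {set V}) (d : V -> nat).
Hypothesis disjAB : [disjoint A & B].
Hypothesis eg : cut_cond set0 (A :|: B) d.
Hypothesis dA : forall x, x \in A -> #|A|.-1 <= d x.
Hypothesis evend : ~~ odd (\sum_(x in A :|: B) d x).

(** The demand left for edges to [B] once [A] is a clique; nothing changes on [B]. *)
Definition outer x := d x - (x \in A) * #|A|.-1.

Lemma outerA x : x \in A -> d x = outer x + #|A|.-1.
Proof. by move=> xA; rewrite /outer xA mul1n subnK ?dA. Qed.

Lemma outerB x : x \in B -> outer x = d x.
Proof. by move=> xB; rewrite /outer (disjointFl disjAB xB) mul0n subn0. Qed.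

Let sumA S : S \subset A -> \sum_(x in S) d x = \sum_(x in S) outer x + #|S| * #|A|.-1.
Proof.
move=> SA; rewrite -sum_nat_const -big_split; apply: eq_bigr => x /(subsetP SA).
exact: outerA.
Qed.

Let sumB (f : nat -> nat) T : T \subset B ->
  \sum_(x in T) f (outer x) = \sum_(x in T) f (d x).
Proof. by move=> TB; apply: eq_bigr => x /(subsetP TB) /outerB ->. Qed.

Lemma even_outer : ~~ odd (\sum_(x in A) outer x + \sum_(x in B) outer x).
Proof.
move: evend; rewrite sum_disjU //= sumA // -(sumB id (subxx B)).
have : ~~ odd (#|A| * #|A|.-1).
  by rewrite oddM; case: #|A| => [|m] //=; case: (odd m).
by rewrite !oddD => /negPf->; rewrite addbF.
Qed.

Let WS S : S \subset A -> (A :|: B) :\: S = (A :\: S) :|: B.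
Proof.
move=> SA; apply/setP => x; rewrite !inE andb_orr; congr (_ || _).
case xB: (x \in B); rewrite ?andbF ?andbT //; apply/negP => /(subsetP SA).
by rewrite (disjointFl disjAB xB).
Qed.

Let disjWS S : [disjoint A :\: S & B].
Proof. by apply: disjointWl disjAB; apply: subsetDl. Qed.

(* If no vertex of [A :\: S] has outer demand below [#|T|], the inequality for
   [(S, T)] is the Erdos-Gallai inequality of [S :|: T]. *)
Let no_short S T : S \subset A -> T \subset B ->
  (forall i, i \in A :\: S -> #|T| <= outer i) \/ #|A| <= #|S|.+1 ->
  (excess A B outer S T <= 0)%R.
Proof.
move=> SA TB H; have := eg (S := set0) (T := S :|: T) (sub0set _).
have dST : [disjoint S & T] by apply: disjointW SA TB disjAB.
rewrite subUset (subset_trans SA (subsetUl _ _)) (subset_trans TB (subsetUr _ _)).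
move=> /(_ isT); rewrite big_set0 cards0 set0D big_set0 sum_disjU //=.
rewrite cardsU (disjoint_setI0 dST) cards0 subn0.
have -> : (A :|: B) :\: (S :|: T) = (A :\: S) :|: (B :\: T).
  rewrite -setDDl WS // setDUl; congr (_ :|: _).
  apply/setP => x; rewrite !inE; case xT: (x \in T) => //=.
  by rewrite (disjointFl disjAB) ?andbF // (subsetP TB).
rewrite sum_disjU //=; last by apply: disjointWr (disjWS S); apply: subsetDl.
rewrite /excess (sumB id TB) (sumB (fun z => minn z (#|S| + #|T|)) (subsetDl B T)) sumA //.
have cAS : #|A :\: S| = #|A| - #|S| by rewrite cardsD (setIidPr SA).
have sA : #|S| <= #|A| by apply: subset_leq_card.
have : \sum_(x in A :\: S) minn (d x) (#|S| + #|T|) <=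
       \sum_(x in A :\: S) minn (outer x) #|T| + #|A :\: S| * #|S|.
  rewrite -sum_nat_const -big_split /=; apply: leq_sum => x xP.
  have xA : x \in A by move: xP; rewrite inE => /andP[].
  have := outerA xA; case: H => [/(_ x xP)|]; last first.
    move=> H; have : 0 < #|A :\: S| by rewrite card_gt0; apply/set0Pn; exists x.
    by move: H; rewrite cAS; clear; lia.
  by clear; lia.
rewrite cAS add0n muln0 mul0n !add0n.
have sp : #|S| * #|A|.-1 + #|S| = #|S| * #|S| + (#|A| - #|S|) * #|S|.
  by move: sA; move: #|S| #|A| => u [|p] /=; clear; nia.
move: sp; move: (_ * _.-1) ((_ - _) * _) => u v.
by clear; lia.
Qed.

(* A violated inequality with [#|S| + #|T|] minimal, combined with the
   Erdos-Gallai inequality of [S], bounds [M + E] by the demands of [T]. If in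
   addition no minimum truncates, the excess is even, which gains one more unit. *)
Lemma clique_cut_cond :
  (forall S T, S \subset A -> T \subset B -> #|S|.+1 < #|A| ->
    (forall y, y \in T -> #|S| + #|T| <= d y) ->
    (forall i, i \in S -> #|T| < outer i) ->
    (exists2 l, l \in A :\: S & outer l < #|T|) ->
    let M := \sum_(x in A :\: S) minn (outer x) #|T| in
    let E := \sum_(x in B :\: T) (minn (d x) (#|S| + #|T|) - minn (d x) #|S|) in
    #|S| * #|T| + #|T| * #|T| + M + E < \sum_(x in T) d x + #|T| ->
    ((forall x, x \in A :\: S -> outer x <= #|T|) ->
     (forall x, x \in B :\: T -> d x <= #|S| + #|T|) ->
     #|S| * #|T| + #|T| * #|T| + M + E + 1 < \sum_(x in T) d x + #|T|) -> False) ->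
  cut_cond A B outer.
Proof.
move=> H; apply: cut_cond_by_minimal => S T SA TB ex dT dS.
have [sA|sA] := leqP #|A| #|S|.+1.
  by have := no_short SA TB (or_intror sA); move: ex; clear; lia.
have [/existsP[l /andP[lP lt]]|/existsPn noshort] :=
   boolP [exists l, (l \in A :\: S) && (outer l < #|T|)]; last first.
  have nosh i : i \in A :\: S -> #|T| <= outer i.
    by move=> iP; have := noshort i; rewrite iP; clear; lia.
  by have := no_short SA TB (or_introl nosh); move: ex; clear; lia.
have egS := eg (S := set0) (T := S) (sub0set _) (subset_trans SA (subsetUl _ _)).
rewrite big_set0 cards0 set0D big_set0 WS // (sum_disjU _ (disjWS S)) /= in egS.
rewrite add0n muln0 mul0n !add0n sumA // in egS.
have cAS : #|A :\: S| = #|A| - #|S| by rewrite cardsD (setIidPr SA).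
have egA : \sum_(x in A :\: S) minn (d x) #|S| <= (#|A| - #|S|) * #|S|.
  by rewrite -cAS -sum_nat_const; apply: leq_sum => x _; apply: geq_minr.
have egB : \sum_(x in B) minn (d x) #|S| =
    #|T| * #|S| + \sum_(x in B :\: T) minn (d x) #|S|.
  rewrite (sum_sub_split _ TB) -sum_nat_const; congr (_ + _).
  apply: eq_bigr => x xT.
  by have := dT x xT; rewrite outerB ?(subsetP TB) //; clear; lia.
have EE : \sum_(x in B :\: T) minn (d x) (#|S| + #|T|) =
   \sum_(x in B :\: T) (minn (d x) (#|S| + #|T|) - minn (d x) #|S|)
   + \sum_(x in B :\: T) minn (d x) #|S|.
  by rewrite -big_split; apply: eq_bigr => x _ /=; clear; lia.
have sp : #|S| * #|A|.-1 + #|S| = #|S| * #|S| + (#|A| - #|S|) * #|S|.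
  by move: sA; move: #|S| #|A| => u [|p] /=; clear; nia.
(* In the inequality of [S] alone, the members of [A :\: S] contribute at most |S| each. These terms
   cancel against the clique edges at [S], and [T] contributes exactly |S| per vertex. *)
have V0 : \sum_(x in S) outer x <= #|S| * #|T| + \sum_(x in B :\: T) minn (d x) #|S|.
  move: egS egA egB sp; move: (_ * _.-1) ((_ - _) * _) => u v.
  clear; lia.
have V1 : #|S| * #|T| + #|T| * #|T| + \sum_(x in A :\: S) minn (outer x) #|T| +
    \sum_(x in B :\: T) (minn (d x) (#|S| + #|T|) - minn (d x) #|S|)
    + `|excess A B outer S T|%N <= \sum_(x in T) d x + #|T|.
  move: ex V0 EE; rewrite /excess (sumB id TB) (sumB (fun z => minn z (#|S| + #|T|)) (subsetDl B T)).
  by clear; lia.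
apply: (H S T) => //.
- by move=> y yT; rewrite -outerB ?dT ?(subsetP TB).
- by exists l.
- by move: V1 ex; move: (excess _ _ _ _ _); clear; lia.
move=> fullA fullB.
suff : (1 < excess A B outer S T)%R.
  by move: V1; move: (excess _ _ _ _ _); clear; lia.
move: ex even_outer; rewrite /excess.
rewrite (sum_sub_split _ SA) (sum_sub_split _ TB).
have -> : \sum_(x in A :\: S) minn (outer x) #|T| = \sum_(x in A :\: S) outer x.
  by apply: eq_bigr => x /fullA; clear; lia.
have -> : \sum_(x in B :\: T) minn (outer x) (#|S| + #|T|) = \sum_(x in B :\: T) outer x.
  apply: eq_bigr => x xP; have := fullB x xP; rewrite outerB; first by clear; lia.
  by move: xP; rewrite inE => /andP[].
have : ~~ odd (#|T| * #|T| + #|T|) by rewrite oddD oddM; case: (odd #|T|).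
by clear; lia.
Qed.

End Reduction.
End Clique.

(** * Degree sum over [B] against a violated inequality *)

Section SumBound.
Variables (V : finType) (B T : {set V}) (d : V -> nat) (s b : nat).
Hypothesis TB : T \subset B.
Hypothesis dB : forall x, x \in B -> d x <= b.
Hypothesis dT : forall x, x \in T -> s + #|T| <= d x.

(** The summand on the right is [d x - s] clipped to the interval from 0 to |T|. Since d x - s <= b
    - s and |T| <= b - s, the clipped value is at least the fraction |T| / (b - s) of [d x - s],
    which is stated without division. *)
Lemma sum_bound :
  #|T| * \sum_(x in B) d x <= #|T| * (#|B| * s) + (b - s) * (#|T| * #|T| +
   \sum_(x in B :\: T) (minn (d x) (s + #|T|) - minn (d x) s)).
Proof.
have [T0|/set0Pn[y yT]] := eqVneq T set0; first by rewrite T0 cards0.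
have bs : s + #|T| <= b := leq_trans (dT yT) (dB (subsetP TB _ yT)).
rewrite (sum_sub_split _ TB).
have cB : #|B| = #|T| + #|B :\: T| by rewrite -(cardsID T B) (setIidPr TB).
have HT : \sum_(x in T) d x <= #|T| * b.
  by rewrite -sum_nat_const; apply: leq_sum => x /(subsetP TB) /dB.
have HB : #|T| * \sum_(x in B :\: T) d x <= #|T| * (#|B :\: T| * s) +
    (b - s) * \sum_(x in B :\: T) (minn (d x) (s + #|T|) - minn (d x) s).
  have -> : #|T| * (#|B :\: T| * s) = \sum_(x in B :\: T) #|T| * s.
    by rewrite sum_nat_const mulnCA.
  rewrite !big_distrr -big_split /=; apply: leq_sum => x.
  rewrite inE => /andP[_ /dB]; move: bs; move: #|T| (d x); clear; nia.
have [g bE] : exists g, b = s + g by exists (b - s); lia.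
rewrite cB; move: HT HB; rewrite bE addKn.
generalize (\sum_(x in T) d x) (\sum_(x in B :\: T) d x) #|T| #|B :\: T|.
generalize (\sum_(x in B :\: T) (minn (d x) (s + #|T|) - minn (d x) s)).
by clear; nia.
Qed.
End SumBound.

(** Here [n], [s], [t] stand for |B|, |S|, |T|, [D] and [X] for the demands of [B] and of [T], and
    [q] for [r - s]. The hypotheses combine to 2qn <= 5n + 8 + 2q(q + 1), impossible for q >= 3
    because [n] is large; q = 2 would give the slope 4 < 5. *)
Lemma arith_flat n s t q D E X :
  3 <= q -> 41 <= n -> 4 * q + 17 <= n -> 0 < t ->
  2 * (s + q) * n <= 2 * D + 5 * n + 8 ->
  t * D <= t * (n * s) + q * (t * t + E) ->
  s * t + t * t + E < X + t -> X <= t * (s + q) -> False.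
Proof.
move=> q3 n41 n4 t0 H1 H2 H3 H4.
have HE : t * t + E + 1 <= t * q + t by nia.
have H5 : q * (t * t + E) + q <= q * (t * q + t) by nia.
have H6 : t * (2 * (s + q) * n) <= t * (2 * D + 5 * n + 8) by rewrite leq_mul2l H1 orbT.
have H7 : t * (2 * q * n) <= t * (5 * n + 8 + 2 * q * (q + 1)) by nia.
have {}H7 : 2 * q * n <= 5 * n + 8 + 2 * q * (q + 1) by rewrite leq_mul2l in H7; lia.
have [e he] : exists e, q = 3 + e by exists (q - 3); lia.
have : e * (4 * e + 29) <= e * n by rewrite leq_mul2l; apply/orP; right; lia.
by rewrite he in H7; move: n41 H7; clear; lia.
Qed.

(** The analogue of [arith_flat] when degrees in [B] may reach [r + a]. The larger range would spoil
    the estimate; the term [(q + 1) * a] supplied by [A :\: S] makes up for it. *)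
Lemma arith_clique n s t q a M D E X :
  3 <= q -> 41 <= n -> 4 * q + 17 <= n -> a < t ->
  2 * (s + q) * n <= 2 * D + 5 * n + 6 ->
  t * D <= t * (n * s) + (q + a) * (t * t + E) ->
  s * t + t * t + M + E < X + t -> X <= t * (s + q + a) -> (q + 1) * a <= M -> False.
Proof.
move=> q3 n41 n4 t0 H1 H2 H3 H4 HM.
have HE : t * t + E + 1 + (q + 1) * a <= t * (q + a) + t by nia.
have tq : t <= q.
  rewrite leqNgt; apply/negP => qt; have [u hu] : exists u, t = q + 1 + u by exists (t - q - 1); lia.
  have : u * a <= u * (q + 1 + u) by rewrite leq_mul2l; apply/orP; right; lia.
  by rewrite hu in HE; move: HE; clear; lia.
have [v hv] : exists v, t = a + 1 + v by exists (t - a - 1); lia.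
have [u hu] : exists u, q = t + u by exists (q - t); lia.
(* The right side is (t - a)(q + 1 - t), the factored form of t(q + a) + t - t^2 - (q + 1)a. *)
have HE2 : E + 1 <= (v + 1) * (u + 1).
  by move: HE; rewrite hu hv; clear; lia.
have H5 : (q + a) * (t * t + E + 1) <= (q + a) * (t * t + (v + 1) * (u + 1)).
  by rewrite leq_mul2l -addnA leq_add2l HE2 orbT.
have H6 : t * (2 * (s + q) * n) <= t * (2 * D + 5 * n + 6) by rewrite leq_mul2l H1 orbT.
have H7 : t * (2 * q * n) + 2 * (q + a) <=
    t * (5 * n + 6) + 2 * ((q + a) * (t * t + (v + 1) * (u + 1))).
  by move: H2 H5 H6; clear; lia.
have h1 : (q + a) * (v + 1) <= q * t.
  have a0 : 0 <= a * u + a * a by [].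
  by move: a0; rewrite hu hv; clear; lia.
have h2 : (q + a) * (v + 1) * (u + 1) <= q * t * (u + 1) by rewrite leq_mul2r h1 orbT.
have [w hw] : exists w, t * t = w + 1 by exists (t * t - 1); move: t0; clear; nia.
have h3 : (q + a) * w <= (q + t - 1) * w.
  by rewrite leq_mul2r; apply/orP; right; move: t0; clear; lia.
have {H5 H6} H8 :
    t * (2 * q * n) <= t * (5 * n + 6) + 2 * ((q + t - 1) * w) + 2 * (q * t * (u + 1)).
  by move: H7 h2 h3; rewrite hw; clear; lia.
have h4 : (q + t - 1) * w + q * t * (u + 1) + (q + t - 1) = t * (t * t + q * (q + 1) - t).
  have tE : q + t - 1 = 2 * a + 1 + 2 * v + u by move: hu hv; clear; lia.
  have : (q + t - 1) * (w + 1) = (q + t - 1) * (t * t) by rewrite hw.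
  have : t * (t * t + q * (q + 1) - t) = t * (t * t) + t * (q * (q + 1)) - t * t.
    by rewrite mulnBr mulnDr.
  have : t * t <= t * (q * (q + 1)).
    by rewrite leq_mul2l hu; apply/orP; right; clear; nia.
  by rewrite tE hu hv; clear; lia.
have h5 : t * t + q * (q + 1) - t <= 2 * q * q by move: tq q3 t0; clear; nia.
have {}H8 : t * (2 * q * n) + 2 * (q + t - 1) <= t * (5 * n + 6 + 2 * (t * t + q * (q + 1) - t)).
  by move: H8 h4; clear; lia.
have [q4|qE] : 4 <= q \/ q = 3 by move: q3; clear; lia.
  have : t * (2 * q * n) <= t * (5 * n + 6 + 4 * q * q).
    apply: leq_trans (leq_trans (leq_addr _ _) H8) _.
    by rewrite leq_mul2l; apply/orP; right; move: h5; clear; lia.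
  have [e he] : exists e, q = 4 + e by exists (q - 4); move: q4; clear; lia.
  have : e * (4 * e + 33) <= e * n.
    by rewrite leq_mul2l; apply/orP; right; move: n4 he; clear; lia.
  by rewrite leq_mul2l he; move: n4 t0; rewrite he; clear; nia.
(* For q = 3 the terms are tight: at t = 3 the main terms only give n <= 42, and the surviving term
   [2 * (q + t - 1)] lowers this below 41. *)
have : t \in [:: 1; 2; 3] by rewrite !inE; move: tq t0 qE; clear; lia.
by rewrite !inE => /or3P[]/eqP tE; move: H8; rewrite tE qE; move: n41; clear; lia.
Qed.

(** * The clique reduction under the degree sum bound, for |A| < r, |A| = r and |A| = r + 1 *)

Section CliqueSums.
Variables (V : finType) (A B : {set V}) (d : V -> nat) (r : nat).
Implicit Types S T : {set V}.
Hypothesis disjAB : [disjoint A & B].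
Hypothesis eg : cut_cond set0 (A :|: B) d.
Hypothesis dA : forall x, x \in A -> #|A|.-1 <= d x.
Hypothesis evend : ~~ odd (\sum_(x in A :|: B) d x).
Hypothesis B41 : 41 <= #|B|.
Hypothesis B4r : 4 * r + 17 <= #|B|.

Let sum_le_const T b : T \subset B -> (forall x, x \in B -> d x <= b) ->
  \sum_(x in T) d x <= #|T| * b.
Proof.
by move=> TB dB; rewrite -sum_nat_const; apply: leq_sum => x /(subsetP TB) /dB.
Qed.

(** The constant 8, against 6 for the original degrees, allows for one unit that a star takes from a
    vertex of [B]. *)
Lemma large_cut_impossible S T E M : #|S| + 3 <= r -> T \subset B ->
  (forall x, x \in B -> d x <= r) ->
  2 * r * #|B| <= 2 * \sum_(x in B) d x + 5 * #|B| + 8 ->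
  (forall y, y \in T -> #|S| + #|T| <= d y) -> 0 < #|T| ->
  E = \sum_(x in B :\: T) (minn (d x) (#|S| + #|T|) - minn (d x) #|S|) ->
  #|S| * #|T| + #|T| * #|T| + M + E < \sum_(x in T) d x + #|T| -> False.
Proof.
move=> sr TB dB HB dT t0 EE V1.
have := sum_bound TB dB dT; rewrite -EE => SB.
have [q qE] : exists q, r = #|S| + q by exists (r - #|S|); move: sr; clear; lia.
have := sum_le_const TB dB; rewrite qE => X.
apply: (arith_flat (q := q) _ B41 _ t0 _ _ _ X); last 2 first.
- by rewrite qE addKn in SB; exact: SB.
- by move: V1; clear; lia.
- by move: sr; rewrite qE; clear; lia.
- by move: B4r; rewrite qE; clear; lia.
- by move: HB; rewrite qE.
Qed.

Lemma clique_small : #|A| < r -> (forall x, x \in B -> d x <= r) ->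
  2 * r * #|B| <= 2 * \sum_(x in B) d x + 5 * #|B| + 8 ->
  cut_cond A B (outer A d).
Proof.
move=> Ar dB HB; apply: clique_cut_cond => // S T SA TB sA dT dS [l _ lt] /= V1 _.
apply: (large_cut_impossible (S := S) _ TB dB HB dT _ erefl V1).
  by move: sA Ar; clear; lia.
by move: lt; clear; lia.
Qed.

(** Only |S| = r - 2 survives the size estimate. Then |T| = 1 and [M] and [E] vanish, so nothing is
    truncated and the unit gained from parity contradicts the degree bound. *)
Lemma clique_medium_low : #|A| = r -> (forall x, x \in B -> d x < r) ->
  2 * r * #|B| <= 2 * \sum_(x in B) d x + 5 * #|B| + 8 ->
  cut_cond A B (outer A d).
Proof.
move=> Ar dB HB; apply: clique_cut_cond => // S T SA TB sA dT dS [l lP lt] /= V1 V2.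
have t0 : 0 < #|T| by move: lt; clear; lia.
have dB' x : x \in B -> d x <= r by move/dB; exact: ltnW.
have [sr|sr] := leqP (#|S| + 3) r.
  exact: (large_cut_impossible sr TB dB' HB dT t0 erefl V1).
have sE : #|S| + 2 = r by move: sr sA; rewrite Ar; clear; lia.
have [y yT] : exists y, y \in T by apply/set0Pn; rewrite -card_gt0.
have t1 : #|T| = 1.
  by have := dT y yT; have := dB y (subsetP TB _ yT); move: t0 sE; clear; lia.
have sumT : \sum_(x in T) d x <= #|S| + 1.
  have /sum_le_const : forall x, x \in B -> d x <= #|S| + 1.
    by move=> x /dB; move: sE; clear; lia.
  by move=> /(_ T TB); rewrite t1 mul1n.
have [M0 E0] : \sum_(x in A :\: S) minn (outer A d x) #|T| = 0 /\
   \sum_(x in B :\: T) (minn (d x) (#|S| + #|T|) - minn (d x) #|S|) = 0.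
  by move: V1 sumT t1; clear => *; split; lia.
rewrite M0 E0 in V2.
have : (#|S| * #|T| + #|T| * #|T| + 0 + 0 + 1 < \sum_(x in T) d x + #|T|).
  apply: V2 => x xP.
    move/eqP: M0; rewrite sum_nat_eq0 => /forallP/(_ x); rewrite xP t1.
    by clear; lia.
  move/eqP: E0; rewrite sum_nat_eq0 => /forallP/(_ x); rewrite xP t1.
  by clear; lia.
by move: sumT t1; clear; lia.
Qed.

(** Two witnesses replace parity when degrees [r] occur in [B]: [c] has outer demand 1, hence stays
    out of [S] and adds to [M]; [e] either belongs to [T] and lowers its sum, or adds to [E]. *)
Lemma clique_medium c e : #|A| = r -> (forall x, x \in B -> d x <= r) ->
  c \in A -> d c = r -> e \in B -> (d e).+1 = r ->
  2 * r * #|B| <= 2 * \sum_(x in B) d x + 5 * #|B| + 8 ->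
  cut_cond A B (outer A d).
Proof.
move=> Ar dB cA dc eB de HB.
apply: clique_cut_cond => // S T SA TB sA dT dS [l lP lt] /= V1 _.
have t0 : 0 < #|T| by move: lt; clear; lia.
have [sr|sr] := leqP (#|S| + 3) r.
  exact: (large_cut_impossible sr TB dB HB dT t0 erefl V1).
have sE : #|S| + 2 = r by move: sr sA; rewrite Ar; clear; lia.
have oc : outer A d c = 1 by rewrite /outer cA mul1n dc Ar; move: sE; clear; lia.
have cS : c \notin S by apply/negP => /dS; rewrite oc; move: t0; clear; lia.
have M1 : 0 < \sum_(x in A :\: S) minn (outer A d x) #|T|.
  rewrite (big_setD1 c) /=; first by rewrite oc; move: t0; clear; lia.
  by rewrite inE cS cA.
have [y yT] : exists y, y \in T by apply/set0Pn; rewrite -card_gt0.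
have t2 : #|T| <= 2.
  by have := dT y yT; have := dB y (subsetP TB _ yT); move: t0 sE; clear; lia.
have [eT|eT] := boolP (e \in T).
  have t1 : #|T| = 1 by have := dT e eT; move: t0 sE de; clear; lia.
  have TE : T = [set e].
    by apply/eqP; rewrite eq_sym eqEcard sub1set eT cards1 t1.
  by move: V1 M1; rewrite TE big_set1 cards1; move: sE de; clear; lia.
have E1 : 0 < \sum_(x in B :\: T) (minn (d x) (#|S| + #|T|) - minn (d x) #|S|).
  rewrite (big_setD1 e) /=; first by move: t0 sE de; clear; lia.
  by rewrite inE eT eB.
have X := sum_le_const TB dB.
have [tE|tE] : #|T| = 1 \/ #|T| = 2 by move: t0 t2; clear; lia.
  by move: V1 M1 E1 sE X; rewrite tE; clear; lia.
by move: V1 M1 E1 sE X; rewrite tE; clear; lia.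
Qed.

(** With q = r - |S| only q = 1 and q = 2 escape [arith_clique]. For q = 2 and a = 0 the last
    alternatives are needed: one forces [M] to be at least [q], the other lowers the demands of
    [T]. *)
Lemma clique_large a : #|A| = r.+1 ->
  (forall x, x \in A -> r + a <= d x) -> (forall x, x \in B -> d x <= r + a) ->
  2 * r * #|B| <= 2 * \sum_(x in B) d x + 5 * #|B| + 6 ->
  [\/ 0 < a, exists c, forall x, x \in A -> x != c -> r < d x |
      forall x, x \in B -> d x < r] ->
  cut_cond A B (outer A d).
Proof.
move=> Ar dAa dB HB Hc.
apply: clique_cut_cond => // S T SA TB sA dT dS [l lP lt] /= V1 V2.
have t0 : 0 < #|T| by move: lt; clear; lia.
have oA x : x \in A -> d x = outer A d x + r by move/(outerA dA); rewrite Ar.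
have oge x : x \in A -> a <= outer A d x.
  by move=> xA; have := dAa x xA; rewrite (oA x xA); clear; lia.
have lA : l \in A by move: lP; rewrite inE => /andP[].
have at_ : a < #|T| by have := oge l lA; move: lt; clear; lia.
have [q qE] : exists q, r = #|S| + q.
  by exists (r - #|S|); move: sA; rewrite Ar; clear; lia.
have cAS : #|A :\: S| = q.+1.
  by rewrite cardsD (setIidPr SA) Ar qE; clear; lia.
have HM : (q + 1) * a <= \sum_(x in A :\: S) minn (outer A d x) #|T|.
  rewrite addn1 -cAS -sum_nat_const; apply: leq_sum => x.
  by rewrite inE => /andP[_ /oge]; move: at_; clear; lia.
have SB := sum_bound TB dB dT.
have X := sum_le_const TB dB; rewrite qE in X.
have [q3|q3] := leqP 3 q.
  apply: (arith_clique (D := \sum_(x in B) d x) q3 B41 _ at_ _ _ V1 X HM).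
  - by move: B4r; rewrite qE; clear; lia.
  - by move: HB; rewrite qE.
  - by rewrite qE -addnA addKn in SB; exact: SB.
have q1 : 0 < q by move: sA; rewrite Ar qE; clear; lia.
move: V1 V2.
set M := \sum_(x in A :\: S) _ in HM *.
set E := \sum_(x in B :\: T) _ => V1 V2.
(* Every term of [M] is at least [a] and a < |T|, so equality means that each outer demand is
   exactly [a]: no minimum truncates, and parity gives one more unit. *)
have tight : M <= (q + 1) * a -> E = 0 ->
    #|S| * #|T| + #|T| * #|T| + M + E + 1 < \sum_(x in T) d x + #|T|.
  move=> Mle E0; apply: V2 => x xP.
    have : minn (outer A d x) #|T| <= a; last by move: at_; clear; lia.
    move: Mle; rewrite /M (big_setD1 x) //= => Mle.
    have : q * a <= \sum_(z in (A :\: S) :\ x) minn (outer A d z) #|T|.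
      have -> : q = #|(A :\: S) :\ x|.
        by apply/eqP; rewrite -eqSS -cAS (cardsD1 x) xP.
      rewrite -sum_nat_const; apply: leq_sum => z.
      by rewrite !inE => /and3P[_ _ /oge]; move: at_; clear; lia.
    by move: Mle; clear; lia.
  move/eqP: E0; rewrite sum_nat_eq0 => /forallP/(_ x); rewrite xP.
  by move: t0; clear; lia.
have M2 : (exists c, forall x, x \in A -> x != c -> r < d x) -> q <= M.
  case=> c Hcc; apply: (@leq_trans #|(A :\: S) :\ c|).
    by move: (cardsD1 c (A :\: S)) cAS; case: (c \in _) => /=; clear; lia.
  rewrite -sum1_card [X in _ <= X](bigID (fun x => x == c)) /= -[X in X <= _]add0n.
  apply: leq_add => //; rewrite [X in X <= _](eq_bigl (fun x => (x \in A :\: S) && (x != c))).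
    apply: leq_sum => x /andP[]; rewrite inE => /andP[_ xA] /(Hcc x xA).
    by rewrite (oA x xA); move: t0; clear; lia.
  by move=> x; rewrite !inE andbC.
have Blow : (forall x, x \in B -> d x < r) -> \sum_(x in T) d x <= #|T| * (#|S| + q - 1).
  move=> HH; apply: (sum_le_const TB) => x /HH; rewrite qE; clear; lia.
have [y yT] : exists y, y \in T by apply/set0Pn; rewrite -card_gt0.
have yB := subsetP TB _ yT; have dyT := dT y yT.
have [qq|qq] : q = 1 \/ q = 2 by move: q1 q3; clear; lia.
  subst q; have [t1 a0] : #|T| = 1 /\ a = 0.
    by move: V1 X HM at_ (dB y yB) dyT qE; clear; nia.
  have [M0 E0] : M = 0 /\ E = 0.
    by move: V1 X; rewrite t1 a0; clear => *; split; lia.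
  by have := tight _ E0; rewrite M0 E0 t1 a0; move: X; rewrite t1 a0; clear; lia.
subst q; have t2 : #|T| <= 2.
  by move: V1 X HM at_ (dB y yB) dyT qE; clear; nia.
have [t1|{}t2] : #|T| = 1 \/ #|T| = 2 by move: t0 t2; clear; lia.
  have a0 : a = 0 by move: at_; rewrite t1; clear; lia.
  case: Hc => [|/M2|/Blow bl]; first by rewrite a0.
    by move: V1 X; rewrite t1 a0; clear; lia.
  have [M0 E0] : M = 0 /\ E = 0.
    by move: V1 bl; rewrite t1; clear => *; split; lia.
  by have := tight _ E0; rewrite M0 E0 t1 a0; move: bl; rewrite t1; clear; lia.
have [a0|a1] : a = 0 \/ a = 1 by move: at_; rewrite t2; clear; lia.
  case: Hc => [|/M2|/(_ y yB)]; first by rewrite a0.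
    by move: V1 X; rewrite t2 a0; clear; lia.
  by move: dyT; rewrite t2 qE; clear; lia.
have [M0 E0] : M = 3 /\ E = 0.
  by move: V1 X HM; rewrite t2 a1; clear => *; split; lia.
by have := tight _ E0; rewrite M0 E0 t2 a1; move: X; rewrite t2 a1; clear; lia.
Qed.

End CliqueSums.

(** * Stars and embeddings *)

Section Stars.
Variable V : finType.
Implicit Types (A B W N : {set V}) (d : V -> nat) (G : rel V).

Definition realizes W d G :=
  [/\ sgraph G, forall x y, G x y -> x \in W & forall x, x \in W -> valency G x = d x].

Lemma lay_off_vertex W d v N : v \in W -> cut_cond set0 W d ->
  ~~ odd (\sum_(x in W) d x) -> top_in (W :\ v) d N -> #|N| = d v ->
  [/\ cut_cond set0 (W :\ v) (lay_off N d),
      ~~ odd (\sum_(x in W :\ v) lay_off N d x),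
      forall x, x \in N -> 0 < d x &
      forall G, realizes (W :\ v) (lay_off N d) G -> realizes W d (add_star G v N)].
Proof.
move=> vW cr ev topN cN.
have dj : [disjoint [set v] & W :\ v] by rewrite disjoints1 !inE eqxx.
have cr1 := cut_cond_move vW cr.
have ev1 : ~~ odd (\sum_(x in [set v]) d x + \sum_(x in W :\ v) d x).
  by rewrite big_set1 -(big_setD1 v).
have Npos := lay_off_pos cr1 (set11 v) topN cN.
have [NW _] := topN.
have vN : v \notin N by apply/negP => /(subsetP NW); rewrite !inE eqxx.
have s0 : [set v] :\ v = set0 by rewrite setDv.
split=> //.
- by have := cut_cond_lay_off dj cr1 (set11 v) topN cN ev1; rewrite s0.
- by have := even_lay_off dj (set11 v) NW cN Npos ev1; rewrite s0 big_set0.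
move=> G [sG GW Gd].
have Gv y : ~~ G v y by apply/negP => /GW; rewrite !inE eqxx.
split; first exact: sgraph_add_star.
  move=> x y /or3P[/GW|/andP[/eqP-> _]|/andP[_ /(subsetP NW)]] //.
    by rewrite inE => /andP[].
  by rewrite inE => /andP[].
move=> x xW; have [->|xv] := eqVneq x v; first by rewrite valency_add_star_center.
rewrite valency_add_star // Gd ?inE ?xv // /lay_off.
by case: (boolP (x \in N)) => [/Npos|_]; clear; lia.
Qed.

Lemma clique_realizes A B d : [disjoint A & B] ->
  (forall x, x \in A -> #|A|.-1 <= d x) -> ~~ odd (\sum_(x in A :|: B) d x) ->
  cut_cond A B (outer A d) ->
  exists2 G, realizes (A :|: B) d G & {in A &, forall x y, x != y -> G x y}.
Proof.
move=> dj dA ev cr.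
have [G [sG GW GA Gd]] := cut_cond_realizable dj cr (even_outer dj dA ev).
exists (add_clique G A); last first.
  by move=> x y xA yA xy; rewrite /add_clique xA yA xy orbT.
split; first exact: sgraph_add_clique.
  by move=> x y /orP[/GW //|/and3P[xA _ _]]; rewrite inE xA.
move=> x xW; rewrite valency_add_clique // Gd // /outer.
by case: (boolP (x \in A)) => [/dA|_]; rewrite ?mul1n ?mul0n; clear; lia.
Qed.

End Stars.

(** * From a nearly complete set of [r + 1] vertices to a copy of K_{r+1} - U *)

Section Embedding.

Lemma perm_extends (T : finType) m (g t : 'I_m -> T) : injective g -> injective t ->
  exists s : {perm T}, forall i, s (g i) = t i.
Proof.
elim: m g t => [|m IH] g t gi ti; first by exists 1%g; case.
have lw : injective (widen_ord (leqnSn m)) by move=> i j /(congr1 val)/= /val_inj.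
have [s Hs] := IH (g \o widen_ord (leqnSn m)) (t \o widen_ord (leqnSn m))
   (inj_comp gi lw) (inj_comp ti lw).
exists (s * tperm (s (g ord_max)) (t ord_max))%g => i; rewrite permM.
have [->|im] := eqVneq i ord_max; first by rewrite tpermL.
have [j ->] : exists j, i = widen_ord (leqnSn m) j.
  have lt_im : i < m by rewrite ltn_neqAle -ltnS ltn_ord andbT; exact: im.
  by exists (Ordinal lt_im); apply: val_inj.
have jm : widen_ord (leqnSn m) j != ord_max.
  by apply/eqP => /(congr1 val) /= E; have := ltn_ord j; rewrite E ltnn.
have Hj : s (g (widen_ord (leqnSn m) j)) = t (widen_ord (leqnSn m) j) := Hs j.
rewrite tpermD //; last by rewrite Hj eq_sym (inj_eq ti).
by rewrite eq_sym (inj_eq perm_inj) (inj_eq gi).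
Qed.

(** [U] sits on the first [k] positions, the non-edges of [G] on those listed in [l]. A permutation
    of the [r + 1] positions carries the copy of K_3 u P_3 in [U] onto [l], so every non-edge of [G]
    falls on an edge of [U]. *)
Lemma Km_minus_subgraph n r k (U : rel 'I_k) (G : rel 'I_n) (l : seq nat) :
  k <= r + 1 -> r < n -> simple_graph U -> subgraph K3_cup_P3 U -> sgraph G ->
  size l = 7 -> uniq l -> all (fun i => i <= r) l ->
  (forall x y : 'I_n, x < y -> y <= r -> ~~ G x y ->
     exists i j : 'I_7, [/\ K3_cup_P3 i j, x = nth 0 l i :> nat & y = nth 0 l j :> nat]) ->
  subgraph (@Km_minus (r + 1) k U) G.
Proof.
move=> kr rn [Us _] [f [fi fU]] [Gs Gi] sl ul al H.
pose g (i : 'I_7) : 'I_(r + 1) := widen_ord kr (f i).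
have gi : injective g by move=> i j /(congr1 val) /= /val_inj /fi.
have lt_l (i : 'I_7) : nth 0 l i < r + 1.
  by rewrite addn1 ltnS; apply: (allP al); rewrite mem_nth // sl.
pose t (i : 'I_7) : 'I_(r + 1) := Ordinal (lt_l i).
have ti : injective t.
  move=> i j /(congr1 val) /= /eqP; rewrite nth_uniq ?sl // => /eqP E; exact: val_inj.
have [s Hs] := perm_extends gi ti.
have rn1 : r + 1 <= n by rewrite addn1.
exists (fun x => widen_ord rn1 (s x)); split.
  by move=> x y /(congr1 val) /= /val_inj /perm_inj.
have key (x y : 'I_(r + 1)) : s x < s y -> Km_minus U x y ->
    G (widen_ord rn1 (s x)) (widen_ord rn1 (s y)).
  move=> sxy /andP[_ /negP Ke]; apply/negPn/negP => nG; apply: Ke.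
  have [||i [j [Kij xi yj]]] := H _ _ _ _ nG.
  - exact: sxy.
  - by have := ltn_ord (s y); rewrite [X in _ < X]addn1 ltnS.
  have ex : x = g i by apply: (@perm_inj _ s); rewrite Hs; apply: val_inj.
  have ey : y = g j by apply: (@perm_inj _ s); rewrite Hs; apply: val_inj.
  apply/existsP; exists (f i); apply/existsP; exists (f j).
  by rewrite ex ey /= !eqxx /= fU.
move=> x y Kxy; have [sxy|sxy|sxy] := ltngtP (s x) (s y).
- exact: key.
- rewrite Gs; apply: key => //; case/andP: Kxy => xy Kxy; apply/andP; split.
    by rewrite eq_sym.
  apply: contra Kxy => /existsP[a /existsP[b /and3P[ax bY Uab]]].
  by apply/existsP; exists b; apply/existsP; exists a; rewrite bY ax Us.
- by case/andP: Kxy => /eqP[]; apply: (@perm_inj _ s); apply: val_inj.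
Qed.

End Embedding.

(** * Neighbourhoods of stars: initial segments with a few extra vertices *)

Section Prefix.
Variable n : nat.

Definition prefix_set m : {set 'I_n} := [set x : 'I_n | x < m].

Lemma card_prefix m : m <= n -> #|prefix_set m| = m.
Proof.
move=> mn; rewrite /prefix_set cardsE -sum1_card.
by rewrite -(big_ord_widen n (fun=> 1) mn) sum1_card card_ord.
Qed.

Lemma in_prefix m (x : 'I_n) : (x \in prefix_set m) = (x < m).
Proof. by rewrite inE. Qed.

Definition prefix_with m (s : seq nat) : {set 'I_n} :=
  [set x : 'I_n | (x < m) || (val x \in s)].

Lemma in_prefix_with m s (x : 'I_n) :
  (x \in prefix_with m s) = (x < m) || (val x \in s).
Proof. by rewrite inE. Qed.

Lemma card_prefix_with m s : m <= n -> uniq s -> all (fun i => m <= i < n) s ->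
  #|prefix_with m s| = m + size s.
Proof.
move=> mn; elim: s => [|c s IH] /=.
  move=> _ _; rewrite addn0 -[RHS](card_prefix mn); congr #|pred_of_set _|.
  by apply/setP => x; rewrite !inE orbF.
move=> /andP[cs us] /andP[/andP[mc cn] als].
have -> : prefix_with m (c :: s) = Ordinal cn |: prefix_with m s.
  by apply/setP => x; rewrite !inE orbCA -val_eqE.
by rewrite cardsU1 !inE /= negb_or -leqNgt mc cs IH // addnS.
Qed.
End Prefix.

(** * The upper bound *)

Section Upper.
Variables (n r : nat) (D : nat -> nat).
Hypothesis r6 : 6 <= r.
Hypothesis nr : 5 * r + 18 <= n.
Hypothesis Dmono : forall i j, i <= j -> D j <= D i.
Let d (x : 'I_n) := D x.
Hypothesis eg : cut_cond set0 setT d.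
Hypothesis evend : ~~ odd (\sum_x d x).
Variable sg : nat.
Hypothesis sgE : \sum_x d x = sg.
(** The smaller of the two thresholds, (r - 1)(2n - r) - 3(n - r) - 1, with all subtractions
    cleared; it covers both parities. *)
Hypothesis sigma : 2 * r * n + 4 * r <= sg + 5 * n + r * r + 1.

Let tail m : {set 'I_n} := ~: prefix_set n m.

Let in_tail m x : (x \in tail m) = (m <= x).
Proof. by rewrite !inE -leqNgt. Qed.

Let card_tail m : m <= n -> #|tail m| = n - m.
Proof. by move=> mn; rewrite cardsCs setCK card_ord card_prefix. Qed.

Let eg_prefix m : m <= n ->
  sg + m <= m * m + \sum_(x in tail m) (minn (d x) m + d x).
Proof.
move=> mn; have := eg (S := set0) (T := prefix_set n m) (sub0set _) (subsetT _).
rewrite big_set0 cards0 set0D big_set0 card_prefix // setTD -/(tail m) big_split /=.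
have -> : sg = \sum_(x in prefix_set n m) d x + \sum_(x in tail m) d x.
  rewrite -sgE (bigID (fun x => x \in prefix_set n m)) /=; congr (_ + _).
  by apply: eq_bigl => x; rewrite [RHS]inE.
by rewrite !add0n addn0 => H; rewrite addnAC addnA leq_add2r.
Qed.

Let eg_two m m' b b' : m <= m' -> m' <= n ->
  (forall i, m <= i -> D i <= b) -> (forall i, m' <= i -> D i <= b') ->
  sg + m <= m * m + (n - m) * m + (m' - m) * b + (n - m') * b'.
Proof.
move=> mm m'n Hb Hb'; have mn := leq_trans mm m'n.
apply: leq_trans (eg_prefix mn) _; rewrite -!addnA leq_add2l big_split /=.
apply: leq_add.
  by rewrite -card_tail // -sum_nat_const; apply: leq_sum => x _; exact: geq_minr.
have sub : tail m' \subset tail m.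
  by apply/subsetP => x; rewrite !in_tail => /(leq_trans mm).
rewrite (sum_sub_split _ sub) addnC; apply: leq_add.
  have <- : #|tail m :\: tail m'| = m' - m.
    by rewrite cardsD (setIidPr sub) !card_tail //; move: mm m'n; clear; lia.
  rewrite -sum_nat_const; apply: leq_sum => x.
  by rewrite inE => /andP[_]; rewrite in_tail => /Hb.
rewrite -card_tail // -sum_nat_const; apply: leq_sum => x.
by rewrite in_tail => /Hb'.
Qed.

Let B := tail r.+1.

Let cB : #|B| = n - r.+1. Proof. by apply: card_tail; move: nr; clear; lia. Qed.
Let B41 : 41 <= #|B|. Proof. by rewrite cB; move: nr r6; clear; lia. Qed.
Let B4r : 4 * r + 17 <= #|B|. Proof. by rewrite cB; move: nr r6; clear; lia. Qed.

(** The Erdos-Gallai inequality of the first [r + 1] vertices, with every minimum replaced by the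
    degree. Substituting n = r + 1 + |B| in the threshold leaves exactly the constant 6. *)
Let sumB : 2 * r * #|B| <= 2 * \sum_(x in B) d x + 5 * #|B| + 6.
Proof.
have rn : r.+1 <= n by move: nr; clear; lia.
have := eg_prefix rn; rewrite big_split /= -/B.
have : \sum_(x in B) minn (d x) r.+1 <= \sum_(x in B) d x.
  by apply: leq_sum => x _; exact: geq_minl.
move: sigma; rewrite cB.
move: (\sum_(x in B) minn _ _) (\sum_(x in B) d x) => a b.
have [m ->] : exists m, n = r.+1 + m by exists (n - r.+1); rewrite subnKC.
by rewrite addKn; clear; nia.
Qed.

Let D_r : r <= D r + 2.
Proof.
rewrite leqNgt; apply/negP => H.
have : \sum_(x in B) d x <= #|B| * (r - 3).
  rewrite -sum_nat_const; apply: leq_sum => x; rewrite in_tail => rx.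
  by have := Dmono (ltnW rx); rewrite /d; move: H; clear; lia.
move: sumB B41; have [q ->] : exists q, r = q + 3 by exists (r - 3); move: r6; clear; lia.
by rewrite addnK; clear; nia.
Qed.

(** The threshold is used here without slack: the extremal sequence for even n - r attains the bound
    of [eg_two], and [sigma] exceeds that bound by one. *)
Let D_r3 : r <= D (r - 3) + 1 /\ (D (r - 3) < r -> r <= D (r - 2) + 1).
Proof.
have [q qE] : exists q, r = q + 3 by exists (r - 3); move: r6; clear; lia.
have [m mE] : exists m, n = q + 1 + m by exists (n - q - 1); move: nr qE; clear; lia.
have H : D (r - 3) < r -> D (r - 2) + 1 < r -> False.
  move=> H1 H2; have := @eg_two (r - 3) (r - 2) (r - 1) (r - 2).
  have h1 : r - 3 <= r - 2 by clear; lia.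
  have h2 : r - 2 <= n by move: nr; clear; lia.
  have h3 i : r - 3 <= i -> D i <= r - 1 by move/Dmono; move: H1; clear; lia.
  have h4 i : r - 2 <= i -> D i <= r - 2 by move/Dmono; move: H2; clear; lia.
  move=> /(_ h1 h2 h3 h4); move: sigma.
  have -> : r - 3 = q by rewrite qE addnK.
  have -> : r - 2 = q + 1 by rewrite qE; clear; lia.
  have -> : r - 1 = q + 2 by rewrite qE; clear; lia.
  rewrite mE qE; have -> : q + 1 + m - q = m + 1 by clear; lia.
  have -> : q + 1 + m - (q + 1) = m by clear; lia.
  have -> : q + 1 - q = 1 by clear; lia.
  by clear; lia.
split; last by move=> H1; rewrite leqNgt; apply/negP => H2; apply: H => //; move: H2; clear; lia.
rewrite leqNgt; apply/negP => H1.
have /Dmono : r - 3 <= r - 2 by clear; lia.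
by move=> H2; apply: H; move: H1 H2; clear; lia.
Qed.

Let D_r5 : r <= D (r - 5).
Proof.
rewrite leqNgt; apply/negP => H1.
have [q qE] : exists q, r = q + 5 by exists (r - 5); move: r6; clear; lia.
have [m mE] : exists m, n = q + m by exists (n - q); move: nr qE; clear; lia.
have h2 : r - 5 <= n by move: nr; clear; lia.
have h3 i : r - 5 <= i -> D i <= r - 1 by move/Dmono; move: H1; clear; lia.
have := eg_two (leqnn _) h2 h3 h3; move: sigma nr.
have -> : r - 5 = q by rewrite qE addnK.
have -> : r - 1 = q + 4 by rewrite qE; clear; lia.
by rewrite mE qE addKn subnn; clear; nia.
Qed.

(** A drop to r - 2 from index [r + 1] on would cost one unit per vertex of a long tail. The bound
    provides the sixth vertex of degree r - 1 in [case_cubic] and excludes D (r - 4) < r when [D r]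
    is r - 2. *)
Let D_r4 : D (r - 4) < r -> r <= D (r + 1) + 1.
Proof.
move=> H1; rewrite leqNgt; apply/negP => H2.
have [q qE] : exists q, r = q + 4 by exists (r - 4); move: r6; clear; lia.
have [m mE] : exists m, n = q + 5 + m by exists (n - q - 5); move: nr qE; clear; lia.
have h1 : r - 4 <= r + 1 by clear; lia.
have h2 : r + 1 <= n by move: nr; clear; lia.
have h3 i : r - 4 <= i -> D i <= r - 1 by move/Dmono; move: H1; clear; lia.
have h4 i : r + 1 <= i -> D i <= r - 2 by move/Dmono; move: H2; clear; lia.
have := eg_two h1 h2 h3 h4; move: sigma nr.
have -> : r - 4 = q by rewrite qE addnK.
have -> : r - 1 = q + 3 by rewrite qE; clear; lia.
have -> : r - 2 = q + 2 by rewrite qE; clear; lia.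
rewrite mE qE; have -> : q + 5 + m - q = m + 5 by clear; lia.
have -> : q + 4 + 1 - q = 5 by clear; lia.
have -> : q + 5 + m - (q + 4 + 1) = m by clear; lia.
by clear; nia.
Qed.


(* [l] lists the images of the vertices of K_3 u P_3 among the first [r + 1]
   vertices; degrees are indexed from 0, so [D r] is the (r+1)-st largest. *)
Definition near_clique (G : rel 'I_n) := exists l : seq nat,
  [/\ size l = 7, uniq l, all (fun i => i <= r) l &
   forall x y : 'I_n, x < y -> y <= r -> ~~ G x y ->
     exists i j : 'I_7, [/\ K3_cup_P3 i j, x = nth 0 l i :> nat & y = nth 0 l j :> nat]].

Let lt_rn : r < n. Proof. by move: nr; clear; lia. Qed.
Let lt_r1n : r - 1 < n. Proof. by move: nr; clear; lia. Qed.
Let u0 : 'I_n := Ordinal lt_rn.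
Let u1 : 'I_n := Ordinal lt_r1n.

Let evenT : ~~ odd (\sum_(x in [set: 'I_n]) d x).
Proof. by rewrite (eq_bigl xpredT) // => x; rewrite inE. Qed.

Let uniq_offsets s : all (fun i => i <= 6) s -> uniq s -> uniq [seq r - i | i <- s].
Proof.
move=> /allP al us; rewrite map_inj_in_uniq // => i j /al + /al.
by move: r6; clear; lia.
Qed.

Let all_offsets s : all (fun i => i <= r) [seq r - i | i <- s].
Proof. by rewrite all_map; apply/allP => i _ /=; apply: leq_subr. Qed.

Lemma case_clique : r <= D r -> [\/ r < D r, r < D (r - 1) | D (r + 1) < r] ->
  exists2 G, realizes setT d G & near_clique G.
Proof.
move=> Dr Hc; pose A := prefix_set n r.+1.
have AB : A :|: B = setT by rewrite /B /tail setUCr.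
have dj : [disjoint A & B] by rewrite /B /tail -setI_eq0 setICr.
have cA : #|A| = r.+1 by rewrite card_prefix.
have dA x : x \in A -> #|A|.-1 <= d x.
  rewrite in_prefix ltnS cA => /Dmono; exact: leq_trans.
have cr : cut_cond A B (outer A d).
  (* The value D r separates the two sides: degrees in [A] are at least D r, those in [B] at most D
     r. *)
  apply: (@clique_large _ A B d r dj _ dA _ B41 B4r (D r - r)) => //; rewrite ?AB //.
  - by move=> x; rewrite in_prefix subnKC // ltnS => /Dmono.
  - by move=> x; rewrite in_tail subnKC // => /ltnW /Dmono.
  - case: Hc => H; [apply: Or31|apply: Or32|apply: Or33].
    + by rewrite subn_gt0.
    + exists u0 => x; rewrite in_prefix ltnS -val_eqE /= => xr xr'.
      apply: leq_trans H (Dmono _); move: xr xr'; clear; lia.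
    + move=> x; rewrite in_tail -addn1 => /Dmono h; exact: leq_ltn_trans h H.
have [|G RG Gc] := clique_realizes dj dA _ cr; first by rewrite AB.
rewrite AB in RG; exists G => //.
exists (iota (r - 6) 7); split => //; first exact: iota_uniq.
  by apply/allP => i; rewrite mem_iota; move: r6; clear; lia.
move=> x y xy yr; rewrite Gc ?in_prefix ?ltnS //; last by rewrite neq_ltn xy.
exact: leq_trans (ltnW xy) yr.
Qed.

(* Vertex [r] is joined to the first [m] vertices and those in [cs], and the first
   [r] vertices form a clique. *)
Lemma one_star m cs :
  let P i := (i < m) || (i \in cs) in
  m <= r -> uniq cs -> all (fun i => (m <= i < n) && (i != r)) cs ->
  m + size cs = D r ->
  (forall i j, P i -> ~~ P j -> j != r -> D j <= D i) ->
  (forall i, i < r -> r.-1 <= D i - P i) ->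
  (let A := prefix_set n r in let d' := lay_off (prefix_with n m cs) d in
   [disjoint A & B] -> #|A| = r -> (forall x, x \in A -> #|A|.-1 <= d' x) ->
   cut_cond set0 (A :|: B) d' -> ~~ odd (\sum_(x in A :|: B) d' x) ->
   cut_cond A B (outer A d')) ->
  exists2 G, realizes setT d G &
    forall x y : 'I_n, x < y -> y <= r -> ~~ G x y -> y = r :> nat /\ ~~ P x.
Proof.
move=> P mr ucs acs card top hA hcut; pose A := prefix_set n r.
have AB : A :|: B = setT :\ u0.
  by apply/setP => x; rewrite !inE -val_eqE /= -leqNgt; clear; lia.
have dj : [disjoint A & B].
  rewrite -setI_eq0; apply/eqP/setP => x; rewrite !inE -leqNgt; clear; lia.
have cA : #|A| = r by rewrite card_prefix // ltnW.
pose N := prefix_with n m cs.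
have u0N : u0 \notin N.
  rewrite in_prefix_with negb_or -leqNgt mr /=.
  by apply/negP => /(allP acs); rewrite eqxx andbF.
have topN : top_in (setT :\ u0) d N.
  split; first by apply/subsetP => x xN; rewrite !inE andbT; apply: contraNneq u0N => <-.
  move=> x y; rewrite in_prefix_with => Px.
  by rewrite in_setD in_prefix_with !inE andbT -val_eqE /= => /andP[]; apply: top.
have cN : #|N| = d u0.
  rewrite card_prefix_with //; first exact: leq_trans mr (ltnW lt_rn).
  by apply/allP => i /(allP acs) /andP[].
have [cr ev Npos st] := lay_off_vertex (in_setT u0) eg evenT topN cN.
rewrite -AB in cr ev.
have dA x : x \in A -> #|A|.-1 <= lay_off N d x.
  rewrite in_prefix cA /lay_off in_prefix_with; exact: hA.
have [G RG Gc] := clique_realizes dj dA ev (hcut dj cA dA cr ev).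
rewrite AB in RG; exists (add_star G u0 N); first exact: st.
move=> x y xy yr; rewrite /add_star !negb_or => /and3P[nG _ nN].
have yE : y = r :> nat.
  apply/eqP; rewrite eqn_leq yr leqNgt; apply/negP => yr'.
  by move/negP: nG; apply; apply: Gc; rewrite ?in_prefix ?(ltn_trans xy) // neq_ltn xy.
split=> //; move: nN; have -> : y == u0 by rewrite -val_eqE /= yE.
by rewrite /N in_prefix_with negb_or.
Qed.

Let lay_offE m cs (f : 'I_n -> nat) (x : 'I_n) :
  lay_off (prefix_with n m cs) f x = f x - ((x < m) || (val x \in cs)).
Proof. by rewrite /lay_off in_prefix_with. Qed.

(** [D_r] leaves only D r = r - 1 or r - 2, so vertex [r] misses at most [r - 1] and [r - 2], two
    edges of a triangle. *)
Lemma case_one_star_low : D r < r -> r <= D (r - 1) ->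
  exists2 G, realizes setT d G & near_clique G.
Proof.
move=> Dr Dr1.
have [|||G RG Gn] := one_star (ltnW Dr) (isT : uniq [::]) isT (addn0 _).
- move=> i j; rewrite !orbF -leqNgt => iD jD _; apply: Dmono.
  exact: leq_trans (ltnW iD) jD.
- move=> i ir; have /Dmono : i <= r - 1 by move: ir; clear; lia.
  by move: Dr1; clear; lia.
- move=> A d' dj cA dA cr ev.
  have dB x : x \in B -> d' x = d x.
    rewrite in_tail /d' lay_offE orbF => rx.
    by rewrite ltnNge (leq_trans (ltnW Dr) (ltnW rx)) subn0.
  apply: (@clique_medium_low _ _ _ _ r dj cr dA ev B41 B4r cA).
    move=> x xB; rewrite dB //; move: xB; rewrite in_tail => /ltnW /Dmono h.
    exact: leq_ltn_trans h Dr.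
  by rewrite (eq_bigr _ dB); move: sumB; clear; lia.
exists G => //; exists [seq r - i | i <- [:: 0; 1; 2; 3; 4; 5; 6]].
split; [by []|exact: uniq_offsets|exact: all_offsets|].
move=> x y xy yr nG; have [yE] := Gn x y xy yr nG; rewrite orbF -leqNgt => xD.
have [xE|xE] : x = r - 1 :> nat \/ x = r - 2 :> nat.
  by move: xD D_r xy yE Dr; clear; lia.
  by exists (@Ordinal 7 1 isT), (@Ordinal 7 0 isT); split; rewrite //= ?subn0.
by exists (@Ordinal 7 2 isT), (@Ordinal 7 0 isT); split; rewrite //= ?subn0.
Qed.

(** This is the run of degrees left out by [clique_large]. Because of the tie, vertex [r] may take
    [r + 1] instead of [r - 1]; then [r - 1] keeps demand [r] and [r + 1] drops to r - 1, the two
    witnesses of [clique_medium]. *)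
Lemma case_one_star_tie : D r = r -> D (r - 1) = r -> D (r + 1) = r ->
  exists2 G, realizes setT d G & near_clique G.
Proof.
move=> Dr Dr1 Dr2; have r1n : r + 1 < n by move: nr; clear; lia.
have le1 : r - 1 <= r by clear; lia.
have al : all (fun i => (r - 1 <= i < n) && (i != r)) [:: r + 1].
  by rewrite /= r1n; move: r6; clear; lia.
have ce : r - 1 + size [:: r + 1] = D r by rewrite /= Dr; move: r6; clear; lia.
have [|||G RG Gn] := one_star le1 (isT : uniq [:: r + 1]) al ce.
- move=> i j; rewrite !inE => iP jP jr; have [ij|ji] := leqP i j; first exact: Dmono.
  have [-> /Dmono] : i = r + 1 /\ r - 1 <= j by move: iP jP jr ji; clear; lia.
  by rewrite Dr1 Dr2.
- move=> i ir; rewrite !inE.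
  have /Dmono : i <= r - 1 by move: ir; clear; lia.
  by rewrite Dr1; clear; lia.
- move=> A d' dj cA dA cr ev.
  have u1A : u1 \in A by rewrite in_prefix /=; move: r6; clear; lia.
  have eB : Ordinal r1n \in B by rewrite in_tail /=; clear; lia.
  apply: (@clique_medium _ _ _ _ r dj cr dA ev B41 B4r u1 (Ordinal r1n)) => //.
  + move=> x; rewrite in_tail => /ltnW /Dmono; rewrite Dr /d' lay_offE => h.
    exact: leq_trans (leq_subr _ _) h.
  + by rewrite /d' lay_offE /= !inE /d /= Dr1; move: r6; clear; lia.
  + by rewrite /d' lay_offE /= !inE eqxx orbT /d /= Dr2; move: r6; clear; lia.
  have : \sum_(x in B) d x <= \sum_(x in B) d' x + 1.
    rewrite !(big_setD1 _ eB) /= {1}/d' lay_offE /=.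
    have -> : \sum_(x in B :\ Ordinal r1n) d' x = \sum_(x in B :\ Ordinal r1n) d x.
      apply: eq_bigr => x; rewrite in_setD1 in_tail -val_eqE /= => /andP[xe rx].
      by rewrite /d' lay_offE !inE (negPf xe) orbF ltnNge; move: rx; clear; lia.
    rewrite !inE eqxx orbT addnAC; apply: leq_add; last exact: leqnn.
    by generalize (d (Ordinal r1n)); clear; lia.
  by move: sumB; clear; lia.
exists G => //; exists [seq r - i | i <- [:: 0; 1; 2; 3; 4; 5; 6]].
split; [by []|exact: uniq_offsets|exact: all_offsets|].
move=> x y xy yr nG; have [yE] := Gn x y xy yr nG; rewrite !inE => xD.
have xE : x = r - 1 :> nat by move: xD xy yE; clear; lia.
by exists (@Ordinal 7 1 isT), (@Ordinal 7 0 isT); split; rewrite //= ?subn0.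
Qed.

(* Vertex [r] gets the neighbours [P1], vertex [r - 1] the remaining neighbours
   [P2], and the first [r - 1] vertices form a clique. *)
Lemma two_stars m1 cs1 m2 cs2 :
  let P1 i := (i < m1) || (i \in cs1) in
  let P2 i := (i < m2) || (i \in cs2) in
  D r <= r ->
  m1 <= r -> uniq cs1 -> all (fun i => (m1 <= i < n) && (i != r)) cs1 ->
  m1 + size cs1 = D r ->
  m2 <= r - 1 -> uniq cs2 ->
  all (fun i => [&& m2 <= i < n, i != r & i != r - 1]) cs2 ->
  m2 + size cs2 + P1 (r - 1) = D (r - 1) ->
  (forall i j, P1 i -> ~~ P1 j -> j != r -> D j <= D i) ->
  (forall i j, P2 i -> ~~ P2 j -> j != r -> j != r - 1 -> D j - P1 j <= D i - P1 i) ->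
  (forall i, i < r - 1 -> r - 2 <= D i - P1 i - P2 i) ->
  (forall i, r < i -> P1 i + P2 i <= (i == r + 1)) ->
  exists2 G, realizes setT d G &
    forall x y : 'I_n, x < y -> y <= r -> ~~ G x y ->
      y = r :> nat /\ ~~ P1 x \/ y = r - 1 :> nat /\ ~~ P2 x.
Proof.
move=> P1 P2 Dr m1r u1cs acs1 card1 m2r u2cs acs2 card2 top1 top2 hA hB.
pose A := prefix_set n (r - 1).
have AB : A :|: B = setT :\ u0 :\ u1.
  by apply/setP => x; rewrite !inE -!val_eqE /= -leqNgt; move: r6; clear; lia.
have dj : [disjoint A & B].
  rewrite -setI_eq0; apply/eqP/setP => x; rewrite !inE -leqNgt; move: r6; clear; lia.
have cA : #|A| = r - 1 by rewrite card_prefix // ltnW.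
pose N1 := prefix_with n m1 cs1; pose N2 := prefix_with n m2 cs2.
have u0N : u0 \notin N1.
  rewrite in_prefix_with negb_or -leqNgt m1r /=.
  by apply/negP => /(allP acs1); rewrite eqxx andbF.
have u0N2 : u0 \notin N2.
  rewrite in_prefix_with negb_or -leqNgt (leq_trans m2r) ?leq_subr //=.
  by apply/negP => /(allP acs2); rewrite eqxx andbF.
have u1N2 : u1 \notin N2.
  rewrite in_prefix_with negb_or -leqNgt m2r /=.
  by apply/negP => /(allP acs2); rewrite eqxx !andbF.
have topN1 : top_in (setT :\ u0) d N1.
  split; first by apply/subsetP => x xN; rewrite !inE andbT; apply: contraNneq u0N => <-.
  move=> x y; rewrite in_prefix_with => Px.
  by rewrite in_setD in_prefix_with !inE andbT -val_eqE /= => /andP[]; apply: top1.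
have cN1 : #|N1| = d u0.
  rewrite card_prefix_with //; first exact: leq_trans m1r (ltnW lt_rn).
  by apply/allP => i /(allP acs1) /andP[].
have [cr1 ev1 _ st1] := lay_off_vertex (in_setT u0) eg evenT topN1 cN1.
have topN2 : top_in (setT :\ u0 :\ u1) (lay_off N1 d) N2.
  split.
    apply/subsetP => x xN; rewrite !inE andbT; apply/andP; split.
      by apply: contraNneq u1N2 => <-.
    by apply: contraNneq u0N2 => <-.
  move=> x y; rewrite in_prefix_with => Px.
  rewrite in_setD in_prefix_with !inE andbT -!val_eqE /= => /and3P[Py y1 y0].
  by rewrite /N1 !lay_offE; apply: top2.
have cN2 : #|N2| = lay_off N1 d u1.
  rewrite card_prefix_with //; last by apply/allP => i /(allP acs2) /andP[].
    by rewrite /N1 lay_offE /d /= -card2 addnK.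
  exact: leq_trans m2r (ltnW lt_r1n).
have u1W : u1 \in setT :\ u0.
  by rewrite !inE -val_eqE /=; move: r6; clear; lia.
have [cr ev _ st] := lay_off_vertex u1W cr1 ev1 topN2 cN2.
rewrite -AB in cr ev; set d' := lay_off N2 _ in cr ev st.
have d'E x : d' x = d x - P1 x - P2 x by rewrite /d' /N2 /N1 !lay_offE.
have dA x : x \in A -> #|A|.-1 <= d' x.
  rewrite in_prefix cA d'E => xr; apply: leq_trans (hA x xr); clear; lia.
have crA : cut_cond A B (outer A d').
  apply: (@clique_small _ _ _ _ r dj cr dA ev B41 B4r); first by rewrite cA; move: r6; clear; lia.
    move=> x; rewrite in_tail d'E => /ltnW /Dmono h; rewrite -subnDA.
    exact: leq_trans (leq_subr _ _) (leq_trans h Dr).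
  have r1n : r + 1 < n by move: nr; clear; lia.
  have eB : Ordinal r1n \in B by rewrite in_tail /=; clear; lia.
  (* By [hB] the stars meet [B] at most in vertex [r + 1], and there only once; doubled, this unit
     turns the constant 6 of [sumB] into 8. *)
  have : \sum_(x in B) d x <= \sum_(x in B) d' x + 1.
    rewrite !(big_setD1 _ eB) /= addnAC; apply: leq_add.
      have rr : r < r + 1 by clear; lia.
      rewrite d'E; have := hB (r + 1) rr; rewrite eqxx /=.
      by generalize (d (Ordinal r1n)); clear; lia.
    apply: leq_sum => x; rewrite in_setD1 in_tail -val_eqE /= d'E => /andP[/negPf xe rx].
    by have := hB x rx; rewrite xe; generalize (d x); clear; lia.
  by move: sumB; clear; lia.
have [G RG Gc] := clique_realizes dj dA ev crA.
rewrite AB in RG.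
exists (add_star (add_star G u1 N2) u0 N1); first exact/st1/st.
move=> x y xy yr; rewrite /add_star !negb_or -!andbA.
move=> /and5P[nG _ nN2 _ nN1].
have ry : r - 1 <= y.
  rewrite leqNgt; apply/negP => yr'.
  by move/negP: nG; apply; apply: Gc; rewrite ?in_prefix ?(ltn_trans xy) // neq_ltn xy.
have [yE|yE] : y = r :> nat \/ y = r - 1 :> nat by move: ry yr; clear; lia.
  left; split=> //; move: nN1; have -> : y == u0 by rewrite -val_eqE /= yE.
  by rewrite /N1 in_prefix_with negb_or.
right; split=> //; move: nN2; have -> : y == u1 by rewrite -val_eqE /= yE.
by rewrite /N2 in_prefix_with negb_or.
Qed.

(** * The shapes of the non-edges when vertices [r] and [r - 1] both have degree below [r] *)

Let near_triangle (G : rel 'I_n) :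
  (forall x y : 'I_n, x < y -> y <= r -> ~~ G x y -> r - 2 <= x) -> near_clique G.
Proof.
move=> H; exists [seq r - i | i <- iota 0 7]; split; [by []|exact: uniq_offsets|exact: all_offsets|].
move=> x y xy yr nG; have xr := H x y xy yr nG.
have [[xE yE]|[[xE yE]|[xE yE]]] :
    (x = r - 1 :> nat /\ y = r :> nat) \/ (x = r - 2 :> nat /\ y = r :> nat)
    \/ (x = r - 2 :> nat /\ y = r - 1 :> nat) by move: xr xy yr r6; clear; lia.
- by exists (@Ordinal 7 1 isT), (@Ordinal 7 0 isT); split; rewrite //= ?subn0.
- by exists (@Ordinal 7 2 isT), (@Ordinal 7 0 isT); split; rewrite //= ?subn0.
- by exists (@Ordinal 7 2 isT), (@Ordinal 7 1 isT); split; rewrite //= ?subn0.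
Qed.

(** Both stars use the first r - 2 vertices. The strict drop after index [r - 3] keeps these on top
    after the first star. *)
Lemma case_K3 : D (r - 1) = r - 2 ->
  D r = r - 2 ->
  D (r - 2) < D (r - 3) ->
  r <= D (r - 3) ->
  r - 2 <= D (r - 2) ->
  exists2 G, realizes setT d G & near_clique G.
Proof.
move=> h0 h1 h2 h3 h4.
have [|||||||||||||G RG Gn] := @two_stars (r - 2) [::] (r - 2) [::].
- by move: r6 nr h0 h1 h2 h3 h4; clear; lia.
- by move: r6 nr h0 h1 h2 h3 h4; clear; lia.
- by rewrite /= ?inE ?in_nil; move: r6 nr h0 h1 h2 h3 h4; clear; lia.
- by rewrite /= ?inE ?in_nil; move: r6 nr h0 h1 h2 h3 h4; clear; lia.
- by rewrite /=; move: r6 nr h0 h1 h2 h3 h4; clear; lia.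
- by move: r6 nr h0 h1 h2 h3 h4; clear; lia.
- by rewrite /= ?inE ?in_nil; move: r6 nr h0 h1 h2 h3 h4; clear; lia.
- by rewrite /= ?inE ?in_nil; move: r6 nr h0 h1 h2 h3 h4; clear; lia.
- by rewrite /= ?inE ?in_nil; move: r6 nr h0 h1 h2 h3 h4; clear; lia.
- by move=> i j; rewrite ?inE ?in_nil; move: r6 h0 h1 h2 h3 h4 (@Dmono i j); clear; lia.
- by move=> i j; rewrite ?inE ?in_nil; move: r6 h0 h1 h2 h3 h4 (@Dmono i (r - 3)) (@Dmono (r - 2) j); clear; lia.
- move=> i; rewrite ?inE ?in_nil; move: (@Dmono i (r - 5)) (@Dmono i (r - 4)).
  by move: r6 nr h0 h1 h2 h3 h4 (@Dmono i (r - 3)) (@Dmono i (r - 2)); clear; lia.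
- by move=> i; rewrite ?inE ?in_nil; move: r6 nr h0 h1 h2 h3 h4; clear; lia.
exists G => //.
apply: near_triangle => x y xy yr nG; have := Gn x y xy yr nG; rewrite ?inE ?in_nil.
by move: r6 xy yr; clear; lia.
Qed.

(** Without a drop, the first star leaves [r - 3] below [r - 2], so the second star must take
    [r - 2] instead: the non-edges form the path [r - 2], [r], [r - 1], [r - 3]. *)
Lemma case_P3 : D (r - 1) = r - 2 ->
  D r = r - 2 ->
  D (r - 2) = D (r - 3) ->
  r <= D (r - 3) + 1 ->
  r <= D (r - 4) ->
  exists2 G, realizes setT d G & near_clique G.
Proof.
move=> h0 h1 h2 h3 h4.
have [|||||||||||||G RG Gn] := @two_stars (r - 2) [::] (r - 3) [:: r - 2].
- by move: r6 nr h0 h1 h2 h3 h4; clear; lia.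
- by move: r6 nr h0 h1 h2 h3 h4; clear; lia.
- by rewrite /= ?inE ?in_nil; move: r6 nr h0 h1 h2 h3 h4; clear; lia.
- by rewrite /= ?inE ?in_nil; move: r6 nr h0 h1 h2 h3 h4; clear; lia.
- by rewrite /=; move: r6 nr h0 h1 h2 h3 h4; clear; lia.
- by move: r6 nr h0 h1 h2 h3 h4; clear; lia.
- by rewrite /= ?inE ?in_nil; move: r6 nr h0 h1 h2 h3 h4; clear; lia.
- by rewrite /= ?inE ?in_nil; move: r6 nr h0 h1 h2 h3 h4; clear; lia.
- by rewrite /= ?inE ?in_nil; move: r6 nr h0 h1 h2 h3 h4; clear; lia.
- by move=> i j; rewrite ?inE ?in_nil; move: r6 h0 h1 h2 h3 h4 (@Dmono i j); clear; lia.
- by move=> i j; rewrite ?inE ?in_nil; move: r6 h0 h1 h2 h3 h4 (@Dmono i (r - 2)) (@Dmono (r - 3) j) (@Dmono r j); clear; lia.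
- move=> i; rewrite ?inE ?in_nil; move: (@Dmono i (r - 5)) (@Dmono i (r - 4)).
  by move: r6 nr h0 h1 h2 h3 h4 (@Dmono i (r - 3)) (@Dmono i (r - 2)); clear; lia.
- by move=> i; rewrite ?inE ?in_nil; move: r6 nr h0 h1 h2 h3 h4; clear; lia.
exists G => //.
exists [seq r - i | i <- [:: 4; 5; 6; 2; 0; 1; 3]]; split; [by []|exact: uniq_offsets|exact: all_offsets|].
move=> x y xy yr nG; have := Gn x y xy yr nG; rewrite ?inE ?in_nil => Hxy.
have [[xE yE]|[[xE yE]|[xE yE]]] : (x = r - 2 :> nat /\ y = r :> nat) \/ (x = r - 1 :> nat /\ y = r :> nat) \/ (x = r - 3 :> nat /\ y = r - 1 :> nat).
  by move: Hxy r6 xy yr; clear; lia.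
- by exists (@Ordinal 7 3 isT), (@Ordinal 7 4 isT); split; rewrite //= ?subn0.
- by exists (@Ordinal 7 5 isT), (@Ordinal 7 4 isT); split; rewrite //= ?subn0.
- by exists (@Ordinal 7 6 isT), (@Ordinal 7 5 isT); split; rewrite //= ?subn0.
Qed.

Lemma case_P2 : D (r - 1) = r - 1 ->
  D r = r - 2 ->
  r <= D (r - 3) ->
  r - 1 <= D (r - 2) ->
  exists2 G, realizes setT d G & near_clique G.
Proof.
move=> h0 h1 h2 h3.
have [|||||||||||||G RG Gn] := @two_stars (r - 2) [::] (r - 1) [::].
- by move: r6 nr h0 h1 h2 h3; clear; lia.
- by move: r6 nr h0 h1 h2 h3; clear; lia.
- by rewrite /= ?inE ?in_nil; move: r6 nr h0 h1 h2 h3; clear; lia.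
- by rewrite /= ?inE ?in_nil; move: r6 nr h0 h1 h2 h3; clear; lia.
- by rewrite /=; move: r6 nr h0 h1 h2 h3; clear; lia.
- by move: r6 nr h0 h1 h2 h3; clear; lia.
- by rewrite /= ?inE ?in_nil; move: r6 nr h0 h1 h2 h3; clear; lia.
- by rewrite /= ?inE ?in_nil; move: r6 nr h0 h1 h2 h3; clear; lia.
- by rewrite /= ?inE ?in_nil; move: r6 nr h0 h1 h2 h3; clear; lia.
- by move=> i j; rewrite ?inE ?in_nil; move: r6 h0 h1 h2 h3 (@Dmono i j); clear; lia.
- by move=> i j; rewrite ?inE ?in_nil; move: r6 h0 h1 h2 h3 (@Dmono i (r - 2)) (@Dmono r j); clear; lia.
- move=> i; rewrite ?inE ?in_nil; move: (@Dmono i (r - 5)) (@Dmono i (r - 4)).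
  by move: r6 nr h0 h1 h2 h3 (@Dmono i (r - 3)) (@Dmono i (r - 2)); clear; lia.
- by move=> i; rewrite ?inE ?in_nil; move: r6 nr h0 h1 h2 h3; clear; lia.
exists G => //.
apply: near_triangle => x y xy yr nG; have := Gn x y xy yr nG; rewrite ?inE ?in_nil.
by move: r6 xy yr; clear; lia.
Qed.

(** Vertices [r - 3] and [r - 2] can lose at most one unit each. The tie lets the first star take
    [r - 1] instead of [r - 3]; the non-edges form the path [r - 2], [r], [r - 3], [r - 1]. *)
Lemma case_P3_mixed : D (r - 1) = r - 1 ->
  D r = r - 2 ->
  D (r - 3) = r - 1 ->
  D (r - 2) = r - 1 ->
  r <= D (r - 4) ->
  exists2 G, realizes setT d G & near_clique G.
Proof.
move=> h0 h1 h2 h3 h4.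
have [|||||||||||||G RG Gn] := @two_stars (r - 3) [:: r - 1] (r - 3) [:: r - 2].
- by move: r6 nr h0 h1 h2 h3 h4; clear; lia.
- by move: r6 nr h0 h1 h2 h3 h4; clear; lia.
- by rewrite /= ?inE ?in_nil; move: r6 nr h0 h1 h2 h3 h4; clear; lia.
- by rewrite /= ?inE ?in_nil; move: r6 nr h0 h1 h2 h3 h4; clear; lia.
- by rewrite /=; move: r6 nr h0 h1 h2 h3 h4; clear; lia.
- by move: r6 nr h0 h1 h2 h3 h4; clear; lia.
- by rewrite /= ?inE ?in_nil; move: r6 nr h0 h1 h2 h3 h4; clear; lia.
- by rewrite /= ?inE ?in_nil; move: r6 nr h0 h1 h2 h3 h4; clear; lia.
- by rewrite /= ?inE ?in_nil; move: r6 nr h0 h1 h2 h3 h4; clear; lia.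
- by move=> i j; rewrite ?inE ?in_nil; move: r6 h0 h1 h2 h3 h4 (@Dmono i (r - 1)) (@Dmono (r - 3) j); clear; lia.
- by move=> i j; rewrite ?inE ?in_nil; move: r6 h0 h1 h2 h3 h4 (@Dmono i (r - 4)) (@Dmono i (r - 2)) (@Dmono (r - 3) j) (@Dmono r j); clear; lia.
- move=> i; rewrite ?inE ?in_nil; move: (@Dmono i (r - 5)) (@Dmono i (r - 4)).
  by move: r6 nr h0 h1 h2 h3 h4 (@Dmono i (r - 3)) (@Dmono i (r - 2)); clear; lia.
- by move=> i; rewrite ?inE ?in_nil; move: r6 nr h0 h1 h2 h3 h4; clear; lia.
exists G => //.
exists [seq r - i | i <- [:: 4; 5; 6; 2; 0; 3; 1]]; split; [by []|exact: uniq_offsets|exact: all_offsets|].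
move=> x y xy yr nG; have := Gn x y xy yr nG; rewrite ?inE ?in_nil => Hxy.
have [[xE yE]|[[xE yE]|[xE yE]]] : (x = r - 2 :> nat /\ y = r :> nat) \/ (x = r - 3 :> nat /\ y = r :> nat) \/ (x = r - 3 :> nat /\ y = r - 1 :> nat).
  by move: Hxy r6 xy yr; clear; lia.
- by exists (@Ordinal 7 3 isT), (@Ordinal 7 4 isT); split; rewrite //= ?subn0.
- by exists (@Ordinal 7 5 isT), (@Ordinal 7 4 isT); split; rewrite //= ?subn0.
- by exists (@Ordinal 7 5 isT), (@Ordinal 7 6 isT); split; rewrite //= ?subn0.
Qed.

Lemma case_edge : D (r - 1) = r - 1 ->
  D r = r - 1 ->
  r <= D (r - 2) ->
  exists2 G, realizes setT d G & near_clique G.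
Proof.
move=> h0 h1 h2.
have [|||||||||||||G RG Gn] := @two_stars (r - 1) [::] (r - 1) [::].
- by move: r6 nr h0 h1 h2; clear; lia.
- by move: r6 nr h0 h1 h2; clear; lia.
- by rewrite /= ?inE ?in_nil; move: r6 nr h0 h1 h2; clear; lia.
- by rewrite /= ?inE ?in_nil; move: r6 nr h0 h1 h2; clear; lia.
- by rewrite /=; move: r6 nr h0 h1 h2; clear; lia.
- by move: r6 nr h0 h1 h2; clear; lia.
- by rewrite /= ?inE ?in_nil; move: r6 nr h0 h1 h2; clear; lia.
- by rewrite /= ?inE ?in_nil; move: r6 nr h0 h1 h2; clear; lia.
- by rewrite /= ?inE ?in_nil; move: r6 nr h0 h1 h2; clear; lia.
- by move=> i j; rewrite ?inE ?in_nil; move: r6 h0 h1 h2 (@Dmono i j); clear; lia.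
- by move=> i j; rewrite ?inE ?in_nil; move: r6 h0 h1 h2 (@Dmono i (r - 2)) (@Dmono r j); clear; lia.
- move=> i; rewrite ?inE ?in_nil; move: (@Dmono i (r - 5)) (@Dmono i (r - 4)).
  by move: r6 nr h0 h1 h2 (@Dmono i (r - 3)) (@Dmono i (r - 2)); clear; lia.
- by move=> i; rewrite ?inE ?in_nil; move: r6 nr h0 h1 h2; clear; lia.
exists G => //.
apply: near_triangle => x y xy yr nG; have := Gn x y xy yr nG; rewrite ?inE ?in_nil.
by move: r6 xy yr; clear; lia.
Qed.

(** By the tie, vertex [r] skips [r - 2] in favour of [r - 1], whose residual demand r - 2 is then
    met by the first r - 2 vertices; both stars miss [r - 2]. *)
Lemma case_P2_tie : D (r - 2) = r - 1 ->
  D (r - 1) = r - 1 ->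
  D r = r - 1 ->
  r <= D (r - 3) ->
  exists2 G, realizes setT d G & near_clique G.
Proof.
move=> h0 h1 h2 h3.
have [|||||||||||||G RG Gn] := @two_stars (r - 2) [:: r - 1] (r - 2) [::].
- by move: r6 nr h0 h1 h2 h3; clear; lia.
- by move: r6 nr h0 h1 h2 h3; clear; lia.
- by rewrite /= ?inE ?in_nil; move: r6 nr h0 h1 h2 h3; clear; lia.
- by rewrite /= ?inE ?in_nil; move: r6 nr h0 h1 h2 h3; clear; lia.
- by rewrite /=; move: r6 nr h0 h1 h2 h3; clear; lia.
- by move: r6 nr h0 h1 h2 h3; clear; lia.
- by rewrite /= ?inE ?in_nil; move: r6 nr h0 h1 h2 h3; clear; lia.
- by rewrite /= ?inE ?in_nil; move: r6 nr h0 h1 h2 h3; clear; lia.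
- by rewrite /= ?inE ?in_nil; move: r6 nr h0 h1 h2 h3; clear; lia.
- by move=> i j; rewrite ?inE ?in_nil; move: r6 h0 h1 h2 h3 (@Dmono i (r - 1)) (@Dmono (r - 2) j); clear; lia.
- by move=> i j; rewrite ?inE ?in_nil; move: r6 h0 h1 h2 h3 (@Dmono i (r - 3)) (@Dmono (r - 2) j); clear; lia.
- move=> i; rewrite ?inE ?in_nil; move: (@Dmono i (r - 5)) (@Dmono i (r - 4)).
  by move: r6 nr h0 h1 h2 h3 (@Dmono i (r - 3)) (@Dmono i (r - 2)); clear; lia.
- by move=> i; rewrite ?inE ?in_nil; move: r6 nr h0 h1 h2 h3; clear; lia.
exists G => //.
apply: near_triangle => x y xy yr nG; have := Gn x y xy yr nG; rewrite ?inE ?in_nil.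
by move: r6 xy yr; clear; lia.
Qed.

(** Each of [r - 3] and [r - 2] serves exactly one star, so the two non-edges are disjoint; they go
    onto the end edges of the P_3. *)
Lemma case_matching : D (r - 3) = r - 1 ->
  D (r - 2) = r - 1 ->
  D (r - 1) = r - 1 ->
  D r = r - 1 ->
  r <= D (r - 4) ->
  exists2 G, realizes setT d G & near_clique G.
Proof.
move=> h0 h1 h2 h3 h4.
have [|||||||||||||G RG Gn] := @two_stars (r - 2) [:: r - 1] (r - 3) [:: r - 2].
- by move: r6 nr h0 h1 h2 h3 h4; clear; lia.
- by move: r6 nr h0 h1 h2 h3 h4; clear; lia.
- by rewrite /= ?inE ?in_nil; move: r6 nr h0 h1 h2 h3 h4; clear; lia.
- by rewrite /= ?inE ?in_nil; move: r6 nr h0 h1 h2 h3 h4; clear; lia.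
- by rewrite /=; move: r6 nr h0 h1 h2 h3 h4; clear; lia.
- by move: r6 nr h0 h1 h2 h3 h4; clear; lia.
- by rewrite /= ?inE ?in_nil; move: r6 nr h0 h1 h2 h3 h4; clear; lia.
- by rewrite /= ?inE ?in_nil; move: r6 nr h0 h1 h2 h3 h4; clear; lia.
- by rewrite /= ?inE ?in_nil; move: r6 nr h0 h1 h2 h3 h4; clear; lia.
- by move=> i j; rewrite ?inE ?in_nil; move: r6 h0 h1 h2 h3 h4 (@Dmono i (r - 1)) (@Dmono (r - 2) j); clear; lia.
- by move=> i j; rewrite ?inE ?in_nil; move: r6 h0 h1 h2 h3 h4 (@Dmono i (r - 4)) (@Dmono i (r - 2)) (@Dmono (r - 3) j) (@Dmono r j); clear; lia.
- move=> i; rewrite ?inE ?in_nil; move: (@Dmono i (r - 5)) (@Dmono i (r - 4)).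
  by move: r6 nr h0 h1 h2 h3 h4 (@Dmono i (r - 3)) (@Dmono i (r - 2)); clear; lia.
- by move=> i; rewrite ?inE ?in_nil; move: r6 nr h0 h1 h2 h3 h4; clear; lia.
exists G => //.
exists [seq r - i | i <- [:: 4; 5; 6; 2; 0; 1; 3]]; split; [by []|exact: uniq_offsets|exact: all_offsets|].
move=> x y xy yr nG; have := Gn x y xy yr nG; rewrite ?inE ?in_nil => Hxy.
have [[xE yE]|[xE yE]] : (x = r - 2 :> nat /\ y = r :> nat) \/ (x = r - 3 :> nat /\ y = r - 1 :> nat).
  by move: Hxy r6 xy yr; clear; lia.
- by exists (@Ordinal 7 3 isT), (@Ordinal 7 4 isT); split; rewrite //= ?subn0.
- by exists (@Ordinal 7 6 isT), (@Ordinal 7 5 isT); split; rewrite //= ?subn0.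
Qed.

(** Vertices [r - 4], [r - 3], [r - 2] can give one unit each. Two go to vertex [r], one to [r - 1],
    which takes its last neighbour [r + 1] outside. The non-edge at [r] goes into the triangle, the
    two at [r - 1] into the path. *)
Lemma case_cubic : D (r - 4) = r - 1 ->
  D (r - 3) = r - 1 ->
  D (r - 2) = r - 1 ->
  D (r - 1) = r - 1 ->
  D r = r - 1 ->
  D (r + 1) = r - 1 ->
  r <= D (r - 5) ->
  exists2 G, realizes setT d G & near_clique G.
Proof.
move=> h0 h1 h2 h3 h4 h5 h6.
have [|||||||||||||G RG Gn] := @two_stars (r - 4) [:: r - 3; r - 2; r - 1] (r - 4) [:: r - 4; r + 1].
- by move: r6 nr h0 h1 h2 h3 h4 h5 h6; clear; lia.
- by move: r6 nr h0 h1 h2 h3 h4 h5 h6; clear; lia.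
- by rewrite /= ?inE ?in_nil; move: r6 nr h0 h1 h2 h3 h4 h5 h6; clear; lia.
- by rewrite /= ?inE ?in_nil; move: r6 nr h0 h1 h2 h3 h4 h5 h6; clear; lia.
- by rewrite /=; move: r6 nr h0 h1 h2 h3 h4 h5 h6; clear; lia.
- by move: r6 nr h0 h1 h2 h3 h4 h5 h6; clear; lia.
- by rewrite /= ?inE ?in_nil; move: r6 nr h0 h1 h2 h3 h4 h5 h6; clear; lia.
- by rewrite /= ?inE ?in_nil; move: r6 nr h0 h1 h2 h3 h4 h5 h6; clear; lia.
- by rewrite /= ?inE ?in_nil; move: r6 nr h0 h1 h2 h3 h4 h5 h6; clear; lia.
- by move=> i j; rewrite ?inE ?in_nil; move: r6 h0 h1 h2 h3 h4 h5 h6 (@Dmono i (r - 1)) (@Dmono (r - 4) j); clear; lia.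
- by move=> i j; rewrite ?inE ?in_nil; move: r6 h0 h1 h2 h3 h4 h5 h6 (@Dmono i (r - 5)) (@Dmono i (r + 1)) (@Dmono (r - 4) j); clear; lia.
- move=> i; rewrite ?inE ?in_nil; move: (@Dmono i (r - 5)) (@Dmono i (r - 4)).
  by move: r6 nr h0 h1 h2 h3 h4 h5 h6 (@Dmono i (r - 3)) (@Dmono i (r - 2)); clear; lia.
- by move=> i; rewrite ?inE ?in_nil; move: r6 nr h0 h1 h2 h3 h4 h5 h6; clear; lia.
exists G => //.
exists [seq r - i | i <- [:: 0; 4; 5; 3; 1; 2; 6]]; split; [by []|exact: uniq_offsets|exact: all_offsets|].
move=> x y xy yr nG; have := Gn x y xy yr nG; rewrite ?inE ?in_nil => Hxy.
have [[xE yE]|[[xE yE]|[xE yE]]] : (x = r - 4 :> nat /\ y = r :> nat) \/ (x = r - 3 :> nat /\ y = r - 1 :> nat) \/ (x = r - 2 :> nat /\ y = r - 1 :> nat).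
  by move: Hxy r6 xy yr; clear; lia.
- by exists (@Ordinal 7 1 isT), (@Ordinal 7 0 isT); split; rewrite //= ?subn0.
- by exists (@Ordinal 7 3 isT), (@Ordinal 7 4 isT); split; rewrite //= ?subn0.
- by exists (@Ordinal 7 5 isT), (@Ordinal 7 4 isT); split; rewrite //= ?subn0.
Qed.


Theorem degree_sum_near_clique : exists2 G, realizes setT d G & near_clique G.
Proof.
have [h3 h32] := D_r3.
have m10 : D r <= D (r - 1) by apply: Dmono; clear; lia.
have m21 : D (r - 1) <= D (r - 2) by apply: Dmono; clear; lia.
have m32 : D (r - 2) <= D (r - 3) by apply: Dmono; clear; lia.
have m43 : D (r - 3) <= D (r - 4) by apply: Dmono; clear; lia.
have m01 : D (r + 1) <= D r by apply: Dmono; clear; lia.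
have [Dr|Dr] := leqP r (D r).
  have [H|H] := ltnP r (D r); first by apply: case_clique => //; apply: Or31.
  have [H1|H1] := ltnP r (D (r - 1)); first by apply: case_clique => //; apply: Or32.
  have [H2|H2] := ltnP (D (r + 1)) r; first by apply: case_clique => //; apply: Or33.
  by apply: case_one_star_tie; move: Dr H H1 H2 m10 m01; clear; lia.
have [H|H] := leqP r (D (r - 1)); first exact: case_one_star_low.
have r2 := D_r; have [H1|H1] := leqP (D r) (r - 2).
  have Dr2 : D r = r - 2 by move: r2 H1 r6; clear; lia.
  have [H2|H2] := leqP (D (r - 1)) (r - 2).
    have Dr1 : D (r - 1) = r - 2 by move: m10 H2 Dr2; clear; lia.
    have [H3|H3] := ltnP (D (r - 2)) (D (r - 3)).
      apply: case_K3 => //; last by move: m21 Dr1; clear; lia.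
      (* If D (r - 3) < r, then [h32] would put D (r - 2) at r - 1 or more, against the strict
         drop. *)
      rewrite leqNgt; apply/negP => H4; have := h32 H4; move: H3 H4 r6; clear; lia.
    apply: case_P3 => //; first by move: H3 m32; clear; lia.
    rewrite leqNgt; apply/negP => /D_r4; move: m01 Dr2 r6; clear; lia.
  have Dr1 : D (r - 1) = r - 1 by move: H H2; clear; lia.
  have [H3|H3] := leqP r (D (r - 3)).
    by apply: case_P2 => //; move: m21 Dr1; clear; lia.
  apply: case_P3_mixed => //.
  - by move: h3 H3; clear; lia.
  - by have := h32 H3; move: H3 m32; clear; lia.
  rewrite leqNgt; apply/negP => /D_r4; move: m01 Dr2 r6; clear; lia.
have Dr1 : D r = r - 1 by move: Dr H1; clear; lia.
have Dr2 : D (r - 1) = r - 1 by move: m10 H Dr1; clear; lia.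
have [H2|H2] := leqP r (D (r - 2)); first exact: case_edge.
have Dr3 : D (r - 2) = r - 1 by move: m21 H2 Dr2; clear; lia.
have [H3|H3] := leqP r (D (r - 3)); first exact: case_P2_tie.
have Dr4 : D (r - 3) = r - 1 by move: m32 H3 Dr3; clear; lia.
have [H4|H4] := leqP r (D (r - 4)); first exact: case_matching.
apply: case_cubic => //.
- by move: m43 H4 Dr4; clear; lia.
- by have := D_r4 H4; move: m01 Dr1; clear; lia.
Qed.

End Upper.

(** * The extremal sequence *)

Lemma sumn_ord (s : seq nat) n : size s = n -> \sum_(x < n) nth 0 s x = sumn s.
Proof. by move=> <-; rewrite sumnE (big_nth 0) big_mkord. Qed.

Lemma cut_cond_ext (V : finType) (A B : {set V}) d d' :
  (forall x, d x = d' x) -> cut_cond A B d -> cut_cond A B d'.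
Proof.
move=> E H S T SA TB; have := H S T SA TB.
have F (X : {set V}) g : \sum_(x in X) g (d x) = \sum_(x in X) g (d' x).
  by apply: eq_bigr => x _; rewrite E.
by rewrite (F S id) (F T id) (F _ (minn^~ _)) (F _ (minn^~ _)).
Qed.

Section Extremal.
Variables (n r : nat).
Hypothesis r6 : 6 <= r.
Hypothesis nr : 5 * r + 18 <= n.

Definition extremal_seq := nseq (r - 3) (n - 1) ++
  (if odd (n - r) then nseq (n - r + 3) (r - 2)
   else (r - 1) :: nseq (n - r + 2) (r - 2)).

(** The n - r + 3 vertices that are not universal ask for one more neighbour each; [c] is the extra
    unit needed when their number is odd. *)
Let c : nat := ~~ odd (n - r).

Lemma size_extremal : size extremal_seq = n.
Proof.
rewrite size_cat size_nseq; case: odd => /=; rewrite size_nseq; move: r6 nr; clear; lia.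
Qed.

Lemma nth_extremal i : nth 0 extremal_seq i =
  if i < r - 3 then n - 1 else if i == r - 3 then r - 2 + c
  else if i < n then r - 2 else 0.
Proof.
rewrite nth_cat size_nseq; case: ltnP => ir; first by rewrite nth_nseq ir.
rewrite /c; case: odd => /=.
  rewrite nth_nseq addn0; case: eqP => [->|ne].
    by rewrite subnn; move: r6; clear; case: ifP => //; lia.
  have -> : (i - (r - 3) < n - r + 3) = (i < n) by move: ir r6 nr; clear; lia.
  by [].
case: eqP => [->|ne]; first by rewrite subnn /=; move: r6; clear; lia.
have -> : i - (r - 3) = (i - (r - 2)).+1 by move: ir ne r6; clear; lia.
rewrite /= nth_nseq.
by have -> : (i - (r - 2) < n - r + 2) = (i < n) by move: ir ne r6 nr; clear; lia.
Qed.

Lemma sumn_extremal : sumn extremal_seq = (r - 3) * (n - 1) + (n - r + 3) * (r - 2) + c.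
Proof.
rewrite sumn_cat sumn_nseq /c; case: odd => /=; rewrite sumn_nseq.
  by rewrite addn0 mulnC [(r - 2) * _]mulnC.
rewrite mulnC [(r - 2) * _]mulnC -addnA; congr (_ + _).
have [q ->] : exists q, r = q + 2 by exists (r - 2); move: r6; clear; lia.
by rewrite addnK; clear; lia.
Qed.

Lemma sorted_extremal : sorted geq extremal_seq.
Proof.
apply/(sortedP 0) => i _; rewrite !nth_extremal /c.
by case: odd; do !case: ifP; move: r6 nr; clear; lia.
Qed.

Let p := r - 3.
Let A := prefix_set n p.
Let B := ~: A.
Let d (x : 'I_n) := nth 0 extremal_seq x.

Let pn : p <= n. Proof. by rewrite /p; move: nr; clear; lia. Qed.
Let cA : #|A| = p. Proof. exact: card_prefix. Qed.
Let cB : #|B| = n - p. Proof. by rewrite cardsCs setCK card_ord cA. Qed.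
Let dj : [disjoint A & B]. Proof. by rewrite -setI_eq0 setICr. Qed.
Let AB : A :|: B = setT. Proof. by rewrite setUCr. Qed.

Let dA x : x \in A -> d x = n - 1.
Proof. by rewrite in_prefix /d nth_extremal => ->. Qed.

Let dB x : x \in B -> d x = r - 2 + (x == p :> nat) * c.
Proof.
rewrite in_setC in_prefix -leqNgt /d nth_extremal => px.
rewrite ltnNge px /= -/p; case: eqP => [_|_]; first by rewrite mul1n.
by rewrite ltn_ord mul0n addn0.
Qed.

(** Checking the criterion replaces an explicit construction: each vertex of [A] has outer demand
    |B|, so the terms at [A] are exact and only the cap |S| + |T| has to be compared with r - 2. *)
Lemma cut_cond_extremal : cut_cond A B (outer A d).
Proof.
move=> S T SA TB.
have sA : #|S| <= p by rewrite -cA subset_leq_card.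
have tB : #|T| <= n - p by rewrite -cB subset_leq_card.
have oA x : x \in A -> outer A d x = n - p.
  by move=> xA; rewrite /outer xA mul1n dA // cA /p; move: r6 nr; clear; lia.
have oB x : x \in B -> outer A d x = d x.
  by move=> xB; rewrite /outer (disjointFl dj xB) mul0n subn0.
have sumS : \sum_(x in S) outer A d x = #|S| * (n - p).
  by rewrite -sum_nat_const; apply: eq_bigr => x /(subsetP SA)/oA.
have sumT : \sum_(x in T) outer A d x <= #|T| * (r - 2) + c /\
            \sum_(x in T) outer A d x <= #|T| * (r - 2) + #|T|.
  have -> : \sum_(x in T) outer A d x =
      #|T| * (r - 2) + (\sum_(x in T) (x == p :> nat)) * c.
    rewrite -sum_nat_const big_distrl -big_split /=; apply: eq_bigr => x /(subsetP TB) xB.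
    by rewrite oB // dB.
  have le1 : \sum_(x in T) (x == p :> nat) <= 1.
    have lt_pn : p < n by rewrite /p; move: nr; clear; lia.
    rewrite (eq_bigr (fun x => nat_of_bool (x \in [set Ordinal lt_pn]))).
      rewrite sum_mem; apply: leq_trans (subset_leq_card (subsetIr _ _)) _.
      by rewrite cards1.
    by move=> x _; rewrite inE -val_eqE.
  have le2 : \sum_(x in T) (x == p :> nat) <= #|T|.
    by rewrite -sum1_card; apply: leq_sum => x _; case: eqP.
  have c1 : c <= 1 by rewrite /c; case: odd.
  by move: le1 le2 c1; move: (\sum_(x in T) _); clear => *; nia.
have sumAS : \sum_(x in A :\: S) minn (outer A d x) #|T| = (p - #|S|) * #|T|.
  have <- : #|A :\: S| = p - #|S| by rewrite cardsD (setIidPr SA) cA.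
  rewrite -sum_nat_const; apply: eq_bigr => x; rewrite inE => /andP[_ /oA ->].
  exact/minn_idPr.
have sumBT : (n - p - #|T|) * minn (r - 2) (#|S| + #|T|) <=
    \sum_(x in B :\: T) minn (outer A d x) (#|S| + #|T|).
  have <- : #|B :\: T| = n - p - #|T| by rewrite cardsD (setIidPr TB) cB.
  rewrite -sum_nat_const; apply: leq_sum => x; rewrite inE => /andP[_ xB].
  by rewrite oB // dB //; clear; lia.
rewrite sumS sumAS; case: sumT => sumT1 sumT2.
have c1 : c <= 1 by rewrite /c; case: odd.
have rp : r - 2 = p + 1 by rewrite /p; move: r6; clear; lia.
rewrite rp in sumT1 sumT2 sumBT.
have [u uE] : exists u, p = #|S| + u by exists (p - #|S|); rewrite subnKC.
have [v vE] : exists v, n - p = #|T| + v by exists (n - p - #|T|); rewrite subnKC.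
have m4 : 4 <= n - p by rewrite /p; move: nr; clear; lia.
move: sumT1 sumT2 sumBT; generalize (\sum_(x in T) outer A d x).
generalize (\sum_(x in B :\: T) minn (outer A d x) (#|S| + #|T|)).
move: m4 c1; rewrite vE uE !addKn; generalize #|S| #|T| c; clear => s t e.
move=> m4 e1 b a a1 a2 b1.
have [k1|k1] := leqP (s + t) (s + u + 1).
  have E : minn (s + u + 1) (s + t) = s + t by apply/minn_idPr.
  rewrite E in b1; case: t m4 a1 a2 b1 k1 {E} => [|t] m4 a1 a2 b1 _.
    by move: a2 b1; clear; nia.
  by move: a1 m4 e1 b1; clear; nia.
have E : minn (s + u + 1) (s + t) = s + u + 1 by apply/minn_idPl; exact: ltnW.
have [w tE] : exists w, t = u + 2 + w by exists (t - u - 2); move: k1; clear; lia.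
by rewrite E in b1; move: a1 m4 e1 b1; rewrite tE; clear; nia.
Qed.

Lemma extremal_graphic : ~~ odd (sumn extremal_seq) -> graphic n extremal_seq.
Proof.
move=> ev; split; first exact: size_extremal.
split; first exact: sorted_extremal.
have ev' : ~~ odd (\sum_(x in A :|: B) d x).
  by rewrite AB (eq_bigl xpredT) ?(sumn_ord size_extremal) // => x; rewrite inE.
have dA' x : x \in A -> #|A|.-1 <= d x.
  by move=> xA; rewrite dA // cA /p; move: nr; clear; lia.
have [G [[Gs Gi] _ Gd] _] := clique_realizes dj dA' ev' cut_cond_extremal.
by exists G; split=> // x; apply: Gd; rewrite AB inE.
Qed.

(** * Copies of K_{r+1} - U in realizations of the extremal sequence *)

Section NoEmbedding.
Variable G : rel 'I_n.
Hypothesis RG : realization extremal_seq G.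

Let Gs : forall x y, G x y = G y x. Proof. by case: RG => -[]. Qed.
Let Gi : forall x, ~~ G x x. Proof. by case: RG => -[]. Qed.

Let full x y : x \in A -> y != x -> G x y.
Proof.
move=> xA yx; have [_ /(_ x)] := RG; rewrite -/(d x) dA // /deg => c1.
have E : [set z | G x z] = [set~ x].
  apply/eqP; rewrite eqEcard cardsC1 card_ord c1 subn1 leqnn andbT.
  by apply/subsetP => z; rewrite !inE => Gxz; apply: contraTneq Gxz => ->.
have : y \in [set~ x] by rewrite !inE.
by rewrite -E inE.
Qed.

Let sparse y : y \in B -> #|[set z in B | G y z]| <= 1 + (y == p :> nat).
Proof.
move=> yB.
have cE : p + #|[set z in B | G y z]| = r - 2 + (y == p :> nat) * c.
  have [_ /(_ y)] := RG; rewrite -/(d y) dB // /deg => <-.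
  have -> : [set z | G y z] = A :|: [set z in B | G y z].
    apply/setP => z; have [zA|zA] := boolP (z \in A); rewrite in_setU.
      rewrite zA in_set Gs full //; apply: contraTneq yB => ->.
      by rewrite in_setC zA.
    by rewrite (negPf zA) !in_set /= -in_prefix zA.
  rewrite cardsU cA (_ : A :&: _ = set0) ?cards0 ?subn0 //.
  by apply/setP => z; rewrite !inE; case: (z < p).
have c1 : c <= 1 by rewrite /c; case: odd.
move: cE; generalize #|[set z in B | G y z]| (y == p :> nat) => w b; rewrite /p.
by case: b; rewrite ?mul1n ?mul0n; move: r6 c1; clear; lia.
Qed.

Variables (k : nat) (U : rel 'I_k).
Hypothesis Us : simple_graph U.
Hypothesis emb : subgraph (@Km_minus (r + 1) k U) G.

Let lift_edge (i j : 'I_(r + 1)) :=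
  [exists a : 'I_k, exists b : 'I_k, [&& val a == val i, val b == val j & U a b]].

(** That [H] has no isolated vertex puts every [w x] among the first [k] positions, where [U]
    lives. *)
Let lift_subgraph (H : rel 'I_4) (w : 'I_4 -> 'I_(r + 1)) : injective w ->
  (forall x, exists y, H x y) -> (forall x y, H x y -> lift_edge (w x) (w y)) ->
  subgraph H U.
Proof.
move=> wi Hn HU.
have lt x : w x < k.
  have [y /HU /existsP[a /existsP[b /and3P[/eqP <- _ _]]]] := Hn x; exact: ltn_ord.
exists (fun x => Ordinal (lt x)); split.
  by move=> x y /(congr1 val) /= /val_inj /wi.
move=> x y /HU /existsP[a /existsP[b /and3P[/eqP ea /eqP eb Uab]]].
have -> : Ordinal (lt x) = a by apply: val_inj.
by have -> : Ordinal (lt y) = b by apply: val_inj.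
Qed.

Lemma extremal_C4_or_Z4 : subgraph C4 U \/ subgraph Z4 U.
Proof.
have [f [fi fG]] := emb.
have edge i j : i != j -> ~~ G (f i) (f j) -> lift_edge i j.
  by move=> ij nG; apply: contraNT nG => nl; apply: fG; rewrite /Km_minus ij.
pose R := [set i : 'I_(r + 1) | f i \in B].
have cR : 3 < #|R|.
  have : #|~: R| <= p.
    rewrite -cA -(card_imset _ fi); apply: subset_leq_card; apply/subsetP => x.
    by move=> /imsetP[i]; rewrite !inE negbK => ip ->.
  by have := cardsC R; rewrite card_ord /p; move: r6; clear; lia.
(* [w0] absorbs the only vertex that may have two neighbours in [B]; any other member of [R] has at
   most one. *)
have [w0 w0R w0p] : exists2 w0, w0 \in R &
    forall i, i \in R -> i != w0 -> f i != p :> nat.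
  have [/existsP[w /andP[wR /eqP wp]]|/existsPn no] :=
      boolP [exists w, (w \in R) && (f w == p :> nat)].
    exists w => // i iR; apply: contraNneq => fip; apply/eqP/fi/val_inj.
    by rewrite /= fip wp.
  have /set0Pn[w wR] : R != set0 by rewrite -card_gt0; apply: leq_trans cR.
  by exists w => // i iR _; have := no i; rewrite iR.
have /card_gt2P[w1 [w2 [w3 [[w1R w2R w3R] [n12 n23 n31]]]]] : 2 < #|R :\ w0|.
  by move: cR; rewrite (cardsD1 w0 R) w0R.
move: w1R w2R w3R; rewrite !in_setD1 => /andP[n10 w1R] /andP[n20 w2R] /andP[n30 w3R].
have RB i : i \in R -> f i \in B by rewrite inE.
have one i j l : i \in R -> i != w0 -> j \in R -> l \in R -> j != l ->
    G (f i) (f j) -> G (f i) (f l) -> False.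
  move=> iR i0 jR lR jl Gij Gil.
  have := sparse (RB i iR); rewrite (negPf (w0p i iR i0)) addn0 leqNgt => /negP; apply.
  by apply/card_gt1P; exists (f j), (f l); split; rewrite ?(inj_eq fi) // in_set (RB, Gij, Gil) ?RB.
have two : G (f w0) (f w1) -> G (f w0) (f w2) -> G (f w0) (f w3) -> False.
  move=> G1 G2 G3.
  have := sparse (RB w0 w0R); rewrite leqNgt => /negP; apply.
  apply: leq_ltn_trans (_ : 2 < _); first by case: eqP.
  apply/card_gt2P; exists (f w1), (f w2), (f w3); split; split; rewrite ?(inj_eq fi) //.
  - by rewrite in_set RB.
  - by rewrite in_set RB.
  - by rewrite in_set RB.
have ls i j : lift_edge i j -> lift_edge j i.
  move=> /existsP[a /existsP[b /and3P[ea eb Uab]]].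
  apply/existsP; exists b; apply/existsP; exists a; rewrite ea eb /=.
  by case: Us => <-.
have cyc a b e g : uniq [:: a; b; e; g] -> lift_edge a b -> lift_edge b e ->
    lift_edge e g -> lift_edge g a -> subgraph C4 U.
  move=> un ab be eg ga; pose w (x : 'I_4) := nth a [:: a; b; e; g] x.
  apply: (@lift_subgraph _ w).
  - by move=> x y /eqP; rewrite nth_uniq // => /eqP /val_inj.
  - move=> x; exists (ordS x); case: x => [[|[|[|[|//]]]] ?] //.
  - case=> [[|[|[|[|//]]]] ?] [[|[|[|[|//]]]] ?] //= _; rewrite /w //=; exact: ls.
have tri a b e g : uniq [:: a; b; e; g] -> lift_edge a b -> lift_edge b e ->
    lift_edge a e -> lift_edge e g -> subgraph Z4 U.
  move=> un ab be ae eg; pose w (x : 'I_4) := nth a [:: a; b; e; g] x.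
  apply: (@lift_subgraph _ w).
  - by move=> x y /eqP; rewrite nth_uniq // => /eqP /val_inj.
  - move=> x; exists (if x == 2 :> nat then @Ordinal 4 3 isT else @Ordinal 4 2 isT).
    by case: x => [[|[|[|[|//]]]] ?].
  - case=> [[|[|[|[|//]]]] ?] [[|[|[|[|//]]]] ?] //= _; rewrite /w //=; exact: ls.
have not i j l : i \in R -> i != w0 -> j \in R -> l \in R -> j != l -> i != l ->
    G (f j) (f i) -> lift_edge i l.
  move=> iR i0 jR lR jl il Gij; apply: edge => //; apply/negP; apply: (one i j l) => //.
  by rewrite Gs.
rewrite eq_sym in n31.
have [n01 n02 n03] : [/\ w0 != w1, w0 != w2 & w0 != w3] by rewrite ![w0 == _]eq_sym.
have [m21 m32 m31] : [/\ w2 != w1, w3 != w2 & w3 != w1] by rewrite ![w3 == _]eq_sym [w2 == _]eq_sym.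
(* Two neighbours of [w0] leave a triangle on [w1], [w2], [w3] with [w0] pendant in [U], a Z_4; in
   all other cases the edges of [G] among the four form a matching, and [U] contains a 4-cycle. *)
have [g01|/(edge _ _ n01) e01] := boolP (G (f w0) (f w1)).
  have e12 : lift_edge w1 w2 by apply: (not w1 w0).
  have e13 : lift_edge w1 w3 by apply: (not w1 w0).
  have [g02|/(edge _ _ n02) e02] := boolP (G (f w0) (f w2)).
    have e23 : lift_edge w2 w3 by apply: (not w2 w0).
    right; apply: (tri w1 w2 w3 w0) => //; last first.
      by apply: edge => //; apply/negP; rewrite Gs; apply: two.
    by rewrite /= !inE !negb_or n12 n31 n10 n23 n20 n30.
  have [g03|/(edge _ _ n03) e03] := boolP (G (f w0) (f w3)).
    have e32 : lift_edge w3 w2 by apply: (not w3 w0).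
    right; apply: (tri w1 w3 w2 w0) => //; last exact: ls.
    by rewrite /= !inE !negb_or n12 n31 n10 m32 n20 n30.
  left; apply: (cyc w0 w2 w1 w3) => //; try exact: ls.
  by rewrite /= !inE !negb_or n01 n02 n03 m21 n23 n31.
have [g02|/(edge _ _ n02) e02] := boolP (G (f w0) (f w2)).
  have e21 : lift_edge w2 w1 by apply: (not w2 w0).
  have e23 : lift_edge w2 w3 by apply: (not w2 w0).
  have [g03|/(edge _ _ n03) e03] := boolP (G (f w0) (f w3)).
    have e31 : lift_edge w3 w1 by apply: (not w3 w0).
    right; apply: (tri w2 w3 w1 w0) => //; last exact: ls.
    by rewrite /= !inE !negb_or n23 m21 n20 m31 n30 n10.
  left; apply: (cyc w0 w1 w2 w3) => //; try exact: ls.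
  by rewrite /= !inE !negb_or n01 n02 n03 n12 n23 n31.
have [g03|/(edge _ _ n03) e03] := boolP (G (f w0) (f w3)).
  have e31 : lift_edge w3 w1 by apply: (not w3 w0).
  have e32 : lift_edge w3 w2 by apply: (not w3 w0).
  left; apply: (cyc w0 w1 w3 w2) => //; try exact: ls.
  by rewrite /= !inE !negb_or n01 n02 n03 n12 m32 n31.
have [g12|/(edge _ _ n12) e12] := boolP (G (f w1) (f w2)).
  have e23 : lift_edge w2 w3 by apply: (not w2 w1).
  have e13 : lift_edge w1 w3 by apply: (not w1 w2) => //; rewrite Gs.
  left; apply: (cyc w0 w1 w3 w2) => //; try exact: ls.
  by rewrite /= !inE !negb_or n01 n02 n03 n12 m32 n31.
have [g13|/(edge _ _ n31) e13] := boolP (G (f w1) (f w3)).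
  have e32 : lift_edge w3 w2 by apply: (not w3 w1).
  left; apply: (cyc w0 w1 w2 w3) => //; try exact: ls.
  by rewrite /= !inE !negb_or n01 n02 n03 n12 n23 n31.
left; apply: (cyc w0 w2 w1 w3) => //; try exact: ls.
by rewrite /= !inE !negb_or n01 n02 n03 m21 n23 n31.
Qed.

End NoEmbedding.
End Extremal.

Lemma threshold_even n r : 6 <= r -> 5 * r + 18 <= n ->
  sumn (extremal_seq n r) + 2 =
    (if odd (n - r) then (r - 1) * (2 * n - r) - 3 * (n - r) - 1
     else (r - 1) * (2 * n - r) - 3 * (n - r)) /\
  ~~ odd (sumn (extremal_seq n r)).
Proof.
move=> r6 nr; rewrite sumn_extremal //.
have [m mE] : exists m, n = r + m by exists (n - r); move: nr; clear; lia.
have [q qE] : exists q, r = q + 3 by exists (r - 3); move: r6; clear; lia.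
have m18 : 18 <= m by move: nr; rewrite mE; clear; lia.
have -> : n - r = m by rewrite mE addKn.
have -> : r - 3 = q by rewrite qE addnK.
have -> : n - 1 = q + 2 + m by rewrite mE qE; clear; lia.
have -> : r - 2 = q + 1 by rewrite qE; clear; lia.
have -> : r - 1 = q + 2 by rewrite qE; clear; lia.
have -> : 2 * n - r = q + 3 + 2 * m by rewrite mE qE; clear; lia.
have par : odd (q * (q + 2 + m) + (m + 3) * (q + 1)) = ~~ odd m.
  by rewrite !(oddD, oddM) /=; case: (odd q); case: (odd m).
split; last by rewrite oddD par; case: (odd m).
by case: (odd m); move: m18; clear; lia.
Qed.

Lemma sorted_geq_nth s i j : sorted geq s -> i <= j -> nth 0 s j <= nth 0 s i.
Proof.
move=> so ij; have [js|js] := ltnP j (size s); last by rewrite nth_default.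
have geq_trans : transitive geq by move=> y x z; rewrite /geq => yx zy; exact: leq_trans zy yx.
have geq_refl : reflexive geq by move=> x; exact: leqnn.
exact: (sorted_leq_nth geq_trans geq_refl 0 so) (leq_ltn_trans ij js) js ij.
Qed.

Theorem theorem1p2 (n r k j : nat) (U : rel 'I_k) :
  5 * r + 18 <= n -> 7 <= k -> k <= r + 1 -> 6 <= j ->
  simple_graph U -> num_edges U = j ->
  subgraph K3_cup_P3 U -> ~ subgraph C4 U -> ~ subgraph Z4 U ->
  is_sigma n (@Km_minus (r + 1) k U)
    (if odd (n - r) then (r - 1) * (2 * n - r) - 3 * (n - r) - 1
     else (r - 1) * (2 * n - r) - 3 * (n - r)).
Proof.
move=> nr k7 kr _ sU _ subU noC4 noZ4.
have r6 : 6 <= r by move: k7 kr; clear; lia.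
have [sE evenE] := threshold_even r6 nr.
set l := (if _ then _ else _) in sE *.
split; first by rewrite -sE oddD addbF.
split=> [pi [size_pi [so [G [[Gs Gi] Gd]]]] le_l|l' ev' Hl']; last first.
  (* An even [l'] below [l] is at most [l - 2], the sum of the extremal sequence. *)
  rewrite leqNgt; apply/negP => lt_l.
  have le_l' : l' <= sumn (extremal_seq n r).
    by move: lt_l ev' evenE; rewrite -sE; move: (sumn _); clear; lia.
  have [G [RG subG]] := Hl' _ (extremal_graphic r6 nr evenE) le_l'.
  by case: (extremal_C4_or_Z4 r6 nr RG sU subG).
have sG : sgraph G by [].
have eg : cut_cond set0 setT (fun x : 'I_n => nth 0 pi x).
  exact: cut_cond_ext Gd (erdos_gallai_necessary sG).
have total : \sum_(x < n) nth 0 pi x = sumn pi by apply: sumn_ord.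
have ev : ~~ odd (\sum_(x < n) nth 0 pi x).
  by rewrite (eq_bigr (valency G)) ?handshake // => x _; rewrite -Gd.
have sg : 2 * r * n + 4 * r <= sumn pi + 5 * n + r * r + 1.
  move: le_l; rewrite -sE sumn_extremal //; generalize (sumn pi) => S.
  have [m ->] : exists m, n = r + m by exists (n - r); move: nr; clear; lia.
  have [q ->] : exists q, r = q + 3 by exists (r - 3); move: r6; clear; lia.
  have -> : q + 3 - 3 = q by rewrite addnK.
  have -> : q + 3 + m - 1 = q + 2 + m by clear; lia.
  have -> : q + 3 + m - (q + 3) = m by rewrite addKn.
  have -> : q + 3 - 2 = q + 1 by clear; lia.
  by clear; lia.
have [H [[Hs Hi] _ Hd] [ll [sl ul al Hn]]] :=
  degree_sum_near_clique r6 nr (fun i j => @sorted_geq_nth pi i j so) eg ev total sg.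
exists H; split; first by split=> // x; apply: Hd; rewrite inE.
apply: (Km_minus_subgraph kr _ sU subU _ sl ul al Hn) => //.
by move: nr; clear; lia.
Qed.
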